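(* Let $n\ge2$ and let $f\in\mathcal{S}(\mathbb{R}^n;E^1(n))$. Then the following conditions are equivalent. (a) The elastic ray transform $X^1f$ of $f$ vanishes, i.e. $X^1f(x,\xi,\zeta)=0$ for all $(x,\xi,\zeta)\in\mathbb{R}^n\times\mathcal{Z}$. (b) There is $\phi\in C^\infty(\mathbb{R}^n)$ such that $f=\mathrm{d}^2\phi$, with $\phi$ and $\partial_{x_i}\phi$ tending to zero as $|x|\to\infty$ for all $i$. (c) The tensor field $f$ is in the kernel of the generalized Saint-Venant operator $\mathcal{R}^1$ defined by $$(\mathcal{R}^1f)_{ijk}(x)=\frac12\left(\frac{\partial f_{ij}}{\partial x_k}(x)-\frac{\partial f_{ik}}{\partial x_j}(x)\right).$$
   Context: $E^1(n)=S^2(\mathbb{R}^n)$ is the space of symmetric $2$-tensors on $\mathbb{R}^n$, and $\mathcal{S}(\mathbb{R}^n;E^1(n))$ is the space of symmetric $2$-tensor fields $f=(f_{ij})$ with Schwartz components. $\mathrm{d}^2\phi$ is the Hessian, $(\mathrm{d}^2\phi)_{ij}=\partial_{x_i}\partial_{x_j}\phi$. Let $\mathcal{Z}=\{(\xi,\zeta):\xi\in\mathbb{S}^{n-1},\ \zeta\in\mathbb{R}\xi\cup\xi^\perp\}$, where $\xi^\perp$ is the hyperplane through the origin orthogonal to $\xi$. The elastic ray transform $X^1$ is $$X^1f(x,\xi,\zeta)=\sum_{i,j=1}^n\int_{\mathbb{R}}f_{ij}(x+t\xi)\,\xi_i\zeta_j\,dt,\qquad (x,\xi,\zeta)\in\mathbb{R}^n\times\mathcal{Z}.$$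 *)

(* Defs.v *)
From HB Require Import structures.
From mathcomp Require Import all_boot all_order all_algebra.
From mathcomp Require Import all_classical all_reals all_analysis.

Set Implicit Arguments.
Unset Strict Implicit.
Unset Printing Implicit Defensive.
Import Order.TTheory GRing.Theory Num.Theory.
Import numFieldNormedType.Exports.

Local Open Scope classical_set_scope.
Local Open Scope ring_scope.

(* Points of R^n are row vectors.  The library's norm on 'rV[R]_n is the sup
   norm, so the Euclidean structure is defined here; the topologies agree. *)
Definition dotp (R : realType) (n : nat) (x y : 'rV[R]_n) : R :=
  \sum_(i < n) x 0 i * y 0 i.

Definition enorm (R : realType) (n : nat) (x : 'rV[R]_n) : R :=
  Num.sqrt (dotp x x).

Definition unit_sphere (R : realType) (n : nat) : set 'rV[R]_n :=
  [set xi | enorm xi = 1].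

Definition at_infty (R : realType) (n : nat) : set_system 'rV[R]_n :=
  [set P | exists M : R, forall x, M < enorm x -> P x].

Global Instance at_infty_filter (R : realType) (n : nat) :
  Filter (@at_infty R n).
Proof.
split; first by exists 0.
- move=> P Q [M MP] [N NQ]; exists (Num.max M N) => x.
  by rewrite gt_max => /andP[Mx Nx]; split; [exact: MP|exact: NQ].
- by move=> P Q PQ [M MP]; exists M => x /MP /PQ.
Qed.

Definition partial (R : realType) (n : nat) (i : 'I_n) (g : 'rV[R]_n -> R) :
  'rV[R]_n -> R := fun x => 'D_(delta_mx 0 i) g x.

(* [:: i1; ...; ik] denotes d_{i1} ... d_{ik}: the last index acts first. *)
Definition iter_partial (R : realType) (n : nat) (s : seq 'I_n)
  (g : 'rV[R]_n -> R) : 'rV[R]_n -> R :=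
  foldr (fun i h => partial i h) g s.

(* C^oo: partial derivatives of all orders exist and are continuous.  Existence
   is explicit because the operator 'D_v is total. *)
Definition smooth (R : realType) (n : nat) (g : 'rV[R]_n -> R) : Prop :=
  forall s : seq 'I_n, continuous (iter_partial s g) /\
    forall (i : 'I_n) (x : 'rV[R]_n),
      derivable (iter_partial s g) x (delta_mx 0 i).

(* sup_x |x^a d^s g (x)| < oo for every multi-index a and all derivatives. *)
Definition schwartz (R : realType) (n : nat) (g : 'rV[R]_n -> R) : Prop :=
  smooth g /\
  forall (a : 'I_n -> nat) (s : seq 'I_n), exists C : R,
    forall x : 'rV[R]_n,
      `|(\prod_(i < n) x 0 i ^+ a i) * iter_partial s g x| <= C.

Definition schwartz_sym_tensor_field (R : realType) (n : nat)
  (f : 'rV[R]_n -> 'M[R]_n) : Prop :=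
  (forall x, (f x)^T = f x) /\
  (forall i j : 'I_n, schwartz (fun x => f x i j)).

Definition hessian (R : realType) (n : nat) (phi : 'rV[R]_n -> R)
  (x : 'rV[R]_n) : 'M[R]_n :=
  \matrix_(i < n, j < n) partial i (partial j phi) x.

Definition Zset (R : realType) (n : nat) : set ('rV[R]_n * 'rV[R]_n) :=
  [set p | unit_sphere p.1 /\
    ([set c *: p.1 | c in [set: R]] `|` [set z | dotp p.1 z = 0]) p.2].

Definition elastic_ray_transform (R : realType) (n : nat)
  (f : 'rV[R]_n -> 'M[R]_n) (x xi zeta : 'rV[R]_n) : R :=
  \sum_(i < n) \sum_(j < n)
    \int[@lebesgue_measure R]_t (f (x + t *: xi) i j * xi 0 i * zeta 0 j).

Definition saint_venant (R : realType) (n : nat) (f : 'rV[R]_n -> 'M[R]_n)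
  (i j k : 'I_n) (x : 'rV[R]_n) : R :=
  2^-1 * (partial k (fun y => f y i j) x - partial j (fun y => f y i k) x).

(* Main.v *)
Require Import Defs.
From mathcomp Require Import all_boot all_order all_algebra.
From mathcomp Require Import all_classical all_reals all_analysis.
From mathcomp Require Import measurable_realfun ring lra.
Import Order.TTheory GRing.Theory Num.Theory.
Import numFieldNormedType.Exports.
Local Open Scope classical_set_scope.
Local Open Scope ring_scope.
Set Implicit Arguments. Unset Strict Implicit. Unset Printing Implicit Defensive.

(** Write [f_j = (f x j i)_i] for the [j]-th row of [f], seen as a one-form on
    R^n.  Condition (c) says that every row is closed.  The implications proved
    are (a) => (c) => (b) => (a).

    (c) => (b).  A closed one-form has a potential, obtained by integrating it
    along rays from the origin.  Since [n >= 2], every point of sup norm [r] is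
    joined to [(r, ..., r)] by two segments on which the norm is at least [r],
    so that the potential of a decaying form has a single limit at infinity;
    once that limit is subtracted, the potential decays with one power less than
    the form ([decaying_potential]).  This gives a potential [v_j] of each row; by
    symmetry of [f] the form [(v_j)_j] is closed in turn, and its decaying
    potential is [phi].

    (b) => (a).  The contraction of [f_j] with the direction of a line is the
    derivative of [partial j phi] along that line, and [partial j phi] vanishes
    at both ends ([Rintegral_derive_eq0]).

    (a) => (c).  As [R xi] and [xi^perp] span R^n, condition (a) says that every
    row has integral zero over every line ([row_line_eq0]).  Restricting to
    planes parallel to two coordinate axes, it remains to see that a decaying
    form [a ds + b dt] of the plane whose line integrals all vanish is closed
    ([plane_form_closed]).  Integration by parts turns the integral of its curl
    against [cos (m1 * s + m2 * t + c)] into the integral of [m1 * b - m2 * a]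
    against the corresponding sine.  This sine is constant on the lines of
    direction [(m2, - m1)], along which [m2 * a - m1 * b] is the restriction of
    the form, so the integral is zero ([plane_integral_wave]): the cosine
    transform of the curl vanishes.

    Hence the curl vanishes, by the following uniqueness argument
    ([cos_transform_eq0]), used in one variable at a time.  A product of cosines
    is a combination of cosines, so a function with zero cosine transform
    integrates to zero against the squares of the products
    [cos (a * t / 2) * cos (a * t / 4) * ... * cos (a * t / 2 ^ K)], which tend
    to [sinc (a * t)] by Viete's formula; and [sinc (a * t) ^+ 2] concentrates
    at the origin as [a] grows. *)

(** * Integrals over the line of functions decaying like [1 / (1 + t ^ 2)] *)

Section RealLine.
Context {R : realType}.
Notation mu := (@lebesgue_measure R).
Implicit Types (g F f : R -> R) (C : R).

(** The dominating function for all integrals over the line. *)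
Definition bump (t : R) : R := (1 + t ^+ 2)^-1.

Lemma bump_gt0 (t : R) : 0 < bump t.
Proof. by rewrite invr_gt0 ltr_pwDl// sqr_ge0. Qed.

Lemma bump_le1 (t : R) : bump t <= 1.
Proof. by rewrite invf_le1 ?ltr_pwDl ?sqr_ge0// lerDl sqr_ge0. Qed.

Lemma continuous_bump : continuous bump.
Proof. exact: continuous_oneDsqrV. Qed.

Lemma integrable_bump : mu.-integrable [set: R] (EFin \o bump).
Proof.
apply/integrableP; split.
  apply/measurable_EFinP. apply: continuous_measurable_fun. exact: continuous_bump.
under eq_integral => t _ do rewrite /= ger0_norm ?(ltW (bump_gt0 _))//.
rewrite ge0_symfun_integralT/=.
- rewrite (_ : [set x : R | 0 <= x] = `[0%R, +oo[%classic); last first.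
    by apply/seteqP; split => t /=; rewrite in_itv/= andbT.
  by rewrite integral0y_oneDsqr -EFinM ltry.
- by move=> t; exact/ltW/bump_gt0.
- exact: continuous_bump.
- by move=> t; rewrite /bump/= sqrrN.
Qed.

Lemma integrable_le_bump g C : measurable_fun [set: R] g ->
  (forall t, `|g t| <= C * bump t) -> mu.-integrable [set: R] (EFin \o g).
Proof.
move=> mg gC.
have h : mu.-integrable [set: R] (fun t => C%:E * (EFin \o bump) t)%E.
  by apply: integrableZl => //; exact: integrable_bump.
apply: le_integrable h => //; first exact/measurable_EFinP.
move=> t _ /=; rewrite lee_fin (le_trans (gC t))//.
by rewrite ler_norm.
Qed.

Lemma Rintegral_norm_le_bump g C : measurable_fun [set: R] g ->
  (forall t, `|g t| <= C * bump t) ->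
  `|\int[mu]_t g t| <= C * \int[mu]_t bump t.
Proof.
move=> mg gC.
have ig := integrable_le_bump mg gC.
rewrite (le_trans (le_normr_Rintegral _ ig))// -RintegralZl//;
    last exact: integrable_bump.
apply: le_Rintegral => //.
  exact: (integrable_norm ig).
exact: (integrableZl _ _ integrable_bump).
Qed.

Lemma Rintegral_bump_ge0 : 0 <= \int[mu]_t bump t.
Proof. by apply: Rintegral_ge0 => t _; exact/ltW/bump_gt0. Qed.

(** Dominated convergence for sequences dominated by a multiple of
    [1 / (1 + t ^ 2)]. *)
Lemma cvg_Rintegral_bump (f_ : nat -> R -> R) g C :
  (forall k, measurable_fun [set: R] (f_ k)) -> measurable_fun [set: R] g ->
  (forall t, f_ k t @[k --> \oo] --> g t) ->
  (forall k t, `|f_ k t| <= C * bump t) ->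
  \int[mu]_t f_ k t @[k --> \oo] --> \int[mu]_t g t.
Proof.
move=> mf mg fg fC.
have gC t : `|g t| <= C * bump t.
  have h : `|f_ k t| @[k --> \oo] --> `|g t| by apply: cvg_norm.
  by rewrite -(cvg_lim _ h)//; apply: limr_le; [exact: cvgP h|near=> k].
have ig := integrable_le_bump mg gC.
have iC : mu.-integrable [set: R] (fun t => (C * bump t)%:E).
  exact: (integrableZl _ _ integrable_bump).
suff h : (\int[mu]_t (f_ k t)%:E)%E @[k --> \oo] --> (\int[mu]_t (g t)%:E)%E.
  by apply: fine_cvg; rewrite fineK; [exact: h|exact: integrable_fin_num].
edestruct (@dominated_convergence _ _ R mu _ measurableT
  (fun k t => (f_ k t)%:E) (EFin \o g)) as [_ _ h]; last exact: h.
- by move=> k; apply/measurable_EFinP; exact: mf.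
- by apply/measurable_EFinP; exact: mg.
- by apply/aeW => t _; apply: cvg_EFin; [exact: nearW|exact: fg].
- exact: iC.
- by apply/aeW => t k _; rewrite lee_fin.
Unshelve. all: by end_near. Qed.

(** The integral over the line of the derivative of a function vanishing at
    both ends is zero. *)
Lemma Rintegral_derive_eq0 F f C :
  (forall t : R, is_derive t 1 F (f t)) -> continuous f ->
  (forall t, `|f t| <= C * bump t) ->
  F t @[t --> +oo] --> 0 -> F t @[t --> -oo] --> 0 ->
  \int[mu]_t f t = 0.
Proof.
move=> dF cf fC Fy FNy.
pose I k : set R := `[- k.+1%:R, k.+1%:R]%classic.
have mI k : measurable (I k) by exact: measurable_itv.
have mf := continuous_measurable_fun cf.
have h1 : \int[mu]_t (f \_ (I k)) t @[k --> \oo] --> \int[mu]_t f t.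
  apply: (@cvg_Rintegral_bump _ _ C) => //.
  - by move=> k; apply/(measurable_restrictT _ (mI k)); exact: measurable_funTS.
  - move=> t; apply: cvg_near_cst; near=> k.
    rewrite patchE mem_set// /I/= in_itv/= -ler_norml.
    rewrite ltW// (lt_le_trans (unstable.ltr_norm_bound _))// ler_nat.
    by apply: leqW; near: k; exact: nbhs_infty_ge.
  - move=> k t; rewrite patchE; case: ifPn => // _.
    by rewrite normr0 (le_trans _ (fC t)).
have h2 : \int[mu]_t (f \_ (I k)) t @[k --> \oo] --> (0 : R).
  have -> : (fun k => \int[mu]_t (f \_ (I k)) t) = (fun k => F k.+1%:R - F (- k.+1%:R)).
    apply/funext => k; rewrite -Rintegral_mkcond /Rintegral.
    rewrite (@continuous_FTC2 _ f F)//.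
    - by rewrite gtrN// ltr0n.
    - exact: continuous_subspaceT.
    - have cF : continuous F.
        by move=> t; apply/differentiable_continuous/derivable1_diffP/ex_derive.
      split => [t _||]; first by case: (dF t).
      + by apply: cvg_at_right_filter; exact: cF.
      + by apply: cvg_at_left_filter; exact: cF.
    - by move=> t _; rewrite derive1E; apply: derive_val.
  have kdvg : (k.+1%:R : R) @[k --> \oo] --> +oo.
    by apply/cvgrnyP; apply: cvg_trans (cvg_addnr 1); apply: near_eq_cvg; near=> k;
        rewrite addn1.
  rewrite -[X in _ --> X](subr0 0); apply: cvgB.
  - apply: (cvg_comp _ _ kdvg Fy).
  - apply: (cvg_comp _ _ _ FNy); exact/cvgNrNy.
by rewrite -(cvg_lim _ h1)// (cvg_lim _ h2).
Unshelve. all: by end_near. Qed.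

Lemma ge0_integral_affine g (c d : R) : 0 < c -> continuous g ->
  (forall t, 0 <= g t) ->
  (\int[mu]_t (g t)%:E)%E = (\int[mu]_t (g (c * t + d) * c)%:E)%E.
Proof.
move=> c0 cg g0.
have dF (t : R) : is_derive t 1 (fun t => c * t + d) c.
  by apply: is_derive_eq; rewrite addr0 /GRing.scale/= mulr1.
have dFE : (fun t : R => c * t + d)^`()%classic = cst c.
  by apply/funext => t; rewrite derive1E; apply: derive_val.
rewrite (@increasing_ge0_integration_by_substitutionT R (fun t => c * t + d))//.
- by rewrite dFE.
- by move=> x y xy; rewrite ltrD2r ltr_pM2l.
- by rewrite dFE => t; exact: cvg_cst.
- by rewrite dFE; exact: is_cvg_cst.
- by rewrite dFE; exact: is_cvg_cst.
- apply/cvgNy_compNP/cvgNry => /=.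
  have -> : - ((fun t => c * t + d) \o -%R) = (fun t : R => c * t - d).
    by apply/funext => t; rewrite !fctE /= mulrN opprD opprK.
  exact: (cvg_comp _ _ (gt0_cvgMry c0 cvg_id) (cvg_addrr (- d))).
- exact: (cvg_comp _ _ (gt0_cvgMry c0 cvg_id) (cvg_addrr d)).
Qed.

Lemma continuous_affine (c d : R) : continuous (fun t : R => c * t + d).
Proof.
by move=> t; apply: cvgD; [apply: cvgM; [exact: cvg_cst|exact: cvg_id]|exact: cvg_cst].
Qed.

Lemma continuous_comp_affine g (c d : R) : continuous g ->
  continuous (fun t => g (c * t + d)).
Proof.
by move=> cg t; exact: (cvg_comp _ _ (@continuous_affine c d t) (cg _)).
Qed.

Lemma integrable_bump_affine (c d : R) : 0 < c ->
  mu.-integrable [set: R] (EFin \o (fun t => bump (c * t + d))).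
Proof.
move=> c0.
have cb := @continuous_comp_affine bump c d continuous_bump.
have mb := continuous_measurable_fun cb.
have E (h : R -> R) : (forall t, 0 <= h t) ->
    (\int[mu]_t `|(EFin \o h) t|)%E = (\int[mu]_t (h t)%:E)%E.
  by move=> h0; apply: eq_integral => t _; rewrite /= ger0_norm.
apply/integrableP; split; first exact/measurable_EFinP.
rewrite E; last by move=> t; exact/ltW/bump_gt0.
have := integrable_bump => /integrableP[_].
rewrite E; last by move=> t; exact/ltW/bump_gt0.
rewrite (ge0_integral_affine d c0 continuous_bump); last first.
  by move=> t; exact/ltW/bump_gt0.
under eq_integral => t _ do rewrite mulrC EFinM.
rewrite ge0_integralZl//; first last.
- by rewrite lee_fin ltW.
- by move=> t _; rewrite lee_fin ltW// bump_gt0.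
- by apply/measurable_EFinP; exact: mb.
case: (\int[mu]_t _)%E => [r _||//]; first by rewrite ltry.
by rewrite gt0_muley ?lte_fin.
Qed.

(** An affine change of variable in the integral over the line. *)
Lemma Rintegral_affine g C (c d : R) : 0 < c -> continuous g ->
  (forall t, `|g t| <= C * bump t) ->
  \int[mu]_t g t = c * \int[mu]_t g (c * t + d).
Proof.
move=> c0 cg gC.
have C0 : 0 <= C.
  have := le_trans (normr_ge0 _) (gC 0).
  by rewrite pmulr_lge0// bump_gt0.
(* The change of variable is available for nonnegative functions; it is applied
   to [g + K] and to [K]. *)
pose K t := C * bump t.
have cK : continuous K.
  by move=> t; apply: cvgM; [exact: cvg_cst|exact: continuous_bump].
have K0 t : 0 <= K t by rewrite mulr_ge0// ltW// bump_gt0.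
have iK : mu.-integrable [set: R] (EFin \o K).
  exact: (integrableZl _ _ integrable_bump).
have iKa : mu.-integrable [set: R] (EFin \o (fun t => K (c * t + d))).
  exact: (integrableZl _ _ (integrable_bump_affine d c0)).
have ig := integrable_le_bump (continuous_measurable_fun cg) gC.
have iga : mu.-integrable [set: R] (EFin \o (fun t => g (c * t + d))).
  apply: (le_integrable measurableT _ _ iKa).
    apply/measurable_EFinP; apply: continuous_measurable_fun.
    exact: continuous_comp_affine.
  by move=> t _; rewrite /= lee_fin (le_trans (gC _))// ler_norm.
have E (h : R -> R) : continuous h -> (forall t : R, 0 <= h t) ->
    mu.-integrable [set: R] (EFin \o (fun t => h (c * t + d))) ->
    \int[mu]_t h t = c * \int[mu]_t h (c * t + d).
  move=> ch h0 ih; rewrite -RintegralZl// /Rintegral; congr fine.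
  rewrite (ge0_integral_affine d c0 ch h0).
  by apply: eq_integral => t _; rewrite mulrC.
have : \int[mu]_t (g t + K t) = c * \int[mu]_t (g (c * t + d) + K (c * t + d)).
  apply: (E (fun t => g t + K t)).
  - by move=> t; apply: cvgD; [exact: cg|exact: cK].
  - by move=> t; have := gC t; rewrite ler_norml => /andP[+ _]; rewrite /K; lra.
  - exact: (integrableD _ iga iKa).
by rewrite !RintegralD// mulrDr (E K)// => /addIr.
Qed.

End RealLine.

(** * Vanishing of a function whose cosine transform vanishes *)

Section Fourier.
Context {R : realType}.
Notation mu := (@lebesgue_measure R).
Implicit Types (g : R -> R) (C : R).

(** The product of the cosines of frequencies listed in [l]. *)
Definition cosprod (l : seq R) (t : R) : R := \prod_(a <- l) cos (a * t).

Lemma cosprod_le1 l t : `|cosprod l t| <= 1.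
Proof.
elim: l => [|a l IH]; first by rewrite /cosprod big_nil normr1.
by rewrite /cosprod big_cons normrM mulr_ile1// ler_norml cos_geN1 cos_le1.
Qed.

Lemma continuous_cosprod l : continuous (cosprod l).
Proof.
elim: l => [|a l IH] t.
  rewrite (_ : cosprod [::] = cst 1); first exact: cvg_cst.
  by apply/funext => u; rewrite /cosprod big_nil.
rewrite (_ : cosprod _ = (fun u => cos (a * u + 0) * cosprod l u)).
  by apply: cvgM; [exact: continuous_comp_affine (@continuous_cos R) _|exact: IH].
by apply/funext => u; rewrite /cosprod big_cons addr0.
Qed.

Section vanishing_transform.
Variables (g : R -> R) (C : R).
Hypothesis cg : continuous g.
Hypothesis gC : forall t, `|g t| <= C * bump t.
Hypothesis g0 : forall m c, \int[mu]_t (g t * cos (m * t + c)) = 0.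

(** Each factor [cos (a * t)] shifts the frequency [m] to [m + a] and [m - a]. *)
Lemma Rintegral_cosprod_cos l m c :
  \int[mu]_t (g t * cosprod l t * cos (m * t + c)) = 0.
Proof.
elim: l m c => [|a l IH] m c.
  rewrite -[RHS](g0 m c); apply: eq_Rintegral => t _.
  by rewrite /cosprod big_nil mulr1.
have int m' : mu.-integrable [set: R]
    (EFin \o (fun t => g t * cosprod l t * cos (m' * t + c))).
  apply: (@integrable_le_bump _ _ C).
    apply: continuous_measurable_fun => t.
    apply: cvgM; last exact: continuous_comp_affine (@continuous_cos R) _.
    by apply: cvgM; [exact: cg|exact: continuous_cosprod].
  move=> t; rewrite -mulrA normrM (le_trans _ (gC t))// ler_piMr//.
  by rewrite normrM mulr_ile1// ?cosprod_le1// ler_norml cos_geN1 cos_le1.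
transitivity (2^-1 * \int[mu]_t (g t * cosprod l t * cos ((m + a) * t + c)
                               + g t * cosprod l t * cos ((m - a) * t + c))).
  rewrite -RintegralZl//; last exact: (integrableD _ (int _) (int _)).
  apply: eq_Rintegral => t _; rewrite /cosprod big_cons.
  rewrite (_ : (m + a) * t + c = (m * t + c) + a * t); last by ring.
  rewrite (_ : (m - a) * t + c = (m * t + c) - a * t); last by ring.
  by move: (m * t + c) => A; rewrite cosB cosD; field.
by rewrite RintegralD// !IH addr0 mulr0.
Qed.

Lemma Rintegral_cosprod l : \int[mu]_t (g t * cosprod l t) = 0.
Proof.
rewrite -[RHS](Rintegral_cosprod_cos l 0 0); apply: eq_Rintegral => t _.
by rewrite mul0r addr0 cos0 mulr1.
Qed.

End vanishing_transform.

(** The cardinal sine, extended by continuity at the origin. *)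
Definition sinc (x : R) : R := if x == 0 then 1 else sin x / x.

Lemma cvg_sinc0 : sin h / h @[h --> (0 : R)^'] --> (1 : R).
Proof.
have [d e] : is_derive (0 : R) 1 sin (cos 0) by exact: is_derive_sin.
rewrite cos0 in e; have := d; rewrite /derivable -[X in _ -> _ --> X]e.
apply: cvg_trans; apply: near_eq_cvg; near=> h.
by rewrite /= scaler1 addr0 sin0 subr0 /GRing.scale/= mulrC.
Unshelve. all: by end_near. Qed.

(** The partial products of Viete's infinite product for [sinc]. *)
Definition viete (K : nat) (x : R) : R := \prod_(1 <= k < K.+1) cos (x / 2 ^+ k).

Lemma vieteE K x : viete K x * (2 ^+ K * sin (x / 2 ^+ K)) = sin x.
Proof.
elim: K => [|K IH].
  by rewrite /viete big_geq// expr0 divr1 !mul1r.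
rewrite -[RHS]IH /viete big_nat_recr//= -mulrA; congr (_ * _).
have -> : x / 2 ^+ K = x / 2 ^+ K.+1 + x / 2 ^+ K.+1.
  by rewrite exprS; field; rewrite expf_neq0.
by rewrite sinD exprS; ring.
Qed.

Lemma viete_le1 K x : `|viete K x| <= 1.
Proof.
rewrite /viete; elim/big_ind : _ => [|a b a1 b1|i _]; first by rewrite normr1.
- by rewrite normrM mulr_ile1.
- by rewrite ler_norml cos_geN1 cos_le1.
Qed.

Lemma cvg_viete x : viete K x @[K --> \oo] --> sinc x.
Proof.
rewrite /sinc; case: eqVneq => [->|x0].
  rewrite (_ : (fun K => viete K 0) = cst 1); first exact: cvg_cst.
  by apply/funext => K; rewrite /viete big1// => k _; rewrite mul0r cos0.
pose h K : R := x / 2 ^+ K.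
have hx K : 2 ^+ K * sin (h K) = x * (sin (h K) / h K).
  by rewrite /h; field; rewrite x0 expf_neq0.
have h0 : h K @[K --> \oo] --> (0 : R).
  have e : ((2^-1 : R) ^+ K) @[K --> \oo] --> (0 : R).
    by apply: cvg_expr; rewrite ger0_norm ?invr_ge0// invf_lt1 ?ltr1n.
  have : x * 2^-1 ^+ K @[K --> \oo] --> x * 0.
    by apply: cvgM; [exact: cvg_cst|exact: e].
  rewrite mulr0; apply: cvg_trans.
  by apply: near_eq_cvg; near=> K; rewrite /h -exprVn.
have cu : 2 ^+ K * sin (h K) @[K --> \oo] --> x.
  have e : sin (h K) / h K @[K --> \oo] --> (1 : R).
    move/cvgr_dnbhsP : cvg_sinc0; apply; split=> // K.
    by rewrite mulf_neq0// invr_neq0// expf_neq0.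
  have : x * (sin (h K) / h K) @[K --> \oo] --> x * 1.
    by apply: cvgM; [exact: cvg_cst|exact: e].
  rewrite mulr1; apply: cvg_trans.
  by apply: near_eq_cvg; near=> K; rewrite hx.
have h1 : sin x / (2 ^+ K * sin (h K)) @[K --> \oo] --> sin x / x.
  by apply: cvgM; [exact: cvg_cst|exact: cvgV].
apply: cvg_trans h1; apply: near_eq_cvg; near=> K.
have u0 : 2 ^+ K * sin (h K) != 0.
  by near: K; exact: (cvgr_neq0 _ cu x0).
by rewrite -(vieteE K x) mulfK.
Unshelve. all: by end_near. Qed.

Lemma cosprod_viete (K : nat) (a t : R) :
  cosprod [seq a / 2 ^+ k | k <- index_iota 1 K.+1] t = viete K (a * t).
Proof.
rewrite /cosprod big_map /viete; apply: eq_bigr => k _.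
by rewrite mulrAC.
Qed.

Lemma sinc_sqr_le (x : R) : x != 0 -> sinc x ^+ 2 <= x ^- 2.
Proof.
move=> x0; rewrite /sinc (negbTE x0) exprMn exprVn ler_piMl//.
  by rewrite invr_ge0 sqr_ge0.
Qed.

Lemma sinc_le1 (x : R) : `|sinc x| <= 1.
Proof.
have h : `|viete K x| @[K --> \oo] --> `|sinc x| by apply: cvg_norm; exact: cvg_viete.
rewrite -(cvg_lim _ h)//; apply: limr_le; first exact: cvgP h.
by apply: nearW => K; exact: viete_le1.
Qed.

Lemma half_lt (e : R) : 0 < e -> e / 2 < e.
Proof. by move=> e0; rewrite ltr_pdivrMr// ltr_pMr// ltr1n. Qed.

Lemma sinc_near0 : exists2 r : R, 0 < r & forall x, `|x| <= r -> 4^-1 <= sinc x ^+ 2.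
Proof.
have := @cvg_sinc0 => /cvgrPdist_lt/(_ 2^-1)[]; first by rewrite invr_gt0.
move=> e /= e0 H; exists (e / 2); first by rewrite divr_gt0.
move=> x xe; rewrite /sinc; case: eqVneq => [_|x0].
  by rewrite expr1n invf_le1// ler1n.
have /(H x) /(_ x0) : `|0 - x| < e by rewrite sub0r normrN (le_lt_trans _ (half_lt _)).
rewrite ltr_distl => /andP[_ h].
rewrite (_ : 4^-1 = 2^-1 ^+ 2 :> R); last by field.
by rewrite ler_sqr ?nnegrE; lra.
Qed.

(** A continuous function decaying like [1 / t ^ 2] whose cosine transform
    vanishes, for all frequencies and phases, vanishes at the origin. *)
Lemma cos_transform_eq0 (g : R -> R) (C : R) : continuous g ->
  (forall t, `|g t| <= C * bump t) ->
  (forall m c, \int[mu]_t (g t * cos (m * t + c)) = 0) -> g 0 = 0.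
Proof.
(* If [0 < g 0], the integral of [g t * sinc (a * t) ^+ 2] gets at least a
   constant times [a^-1] from near the origin, and at most a constant times
   [a ^- 2] from elsewhere, a contradiction for large [a]. *)
wlog g00 : g / 0 <= g 0.
  move=> W cg gC g0; have [|/ltW] := leP 0 (g 0); first by move=> /W; exact.
  rewrite -oppr_ge0 => /(W (fun t => - g t)) h.
  apply: oppr_inj; rewrite oppr0; apply: h.
  - by move=> t; apply: cvgN; exact: cg.
  - by move=> t; rewrite normrN.
  - move=> m c; have ig : mu.-integrable [set: R] (EFin \o (fun t =>
      g t * cos (m * t + c))).
      apply: (@integrable_le_bump _ _ C).
        apply: continuous_measurable_fun => t.
        by apply: cvgM; [exact: cg|exact: continuous_comp_affine (@continuous_cos R) _].
      move=> t; rewrite normrM (le_trans _ (gC t))// ler_piMr//.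
      by rewrite ler_norml cos_geN1 cos_le1.
    under eq_Rintegral do rewrite mulNr -mulN1r.
    by rewrite RintegralZl// g0 mulr0.
move=> cg gC g0; apply/eqP; rewrite eq_le g00 andbT leNgt; apply/negP => gp.
have mg := continuous_measurable_fun cg.
have ig := integrable_le_bump mg gC.
have mv K (a : R) : measurable_fun [set: R] (fun t => viete K (a * t)).
  under eq_fun do rewrite -cosprod_viete.
  by apply: continuous_measurable_fun; exact: continuous_cosprod.
have ms (a : R) : measurable_fun [set: R] (fun t => sinc (a * t)).
  by apply: (measurable_fun_cvg (fun K => mv K a)) => t _; exact: cvg_viete.
have key (a : R) : \int[mu]_t (g t * sinc (a * t) ^+ 2) = 0.
  have h : \int[mu]_t (g t * viete K (a * t) ^+ 2) @[K --> \oo] -->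
      \int[mu]_t (g t * sinc (a * t) ^+ 2).
    apply: (@cvg_Rintegral_bump _ _ _ C).
    - by move=> K; apply: measurable_funM => //; exact: measurable_funX.
    - by apply: measurable_funM => //; exact: measurable_funX.
    - move=> t; apply: cvgM; first exact: cvg_cst.
      by apply: cvgM; exact: cvg_viete.
    - move=> K t; rewrite normrM (le_trans _ (gC t))// ler_piMr//.
      by rewrite normrX exprn_ile1// viete_le1.
  rewrite -(cvg_lim _ h)//; apply: cvg_lim => //.
  apply: cvg_near_cst; apply: nearW => K.
  pose l := [seq a / 2 ^+ k | k <- index_iota 1 K.+1].
  rewrite -[RHS](@Rintegral_cosprod g C cg gC g0 (l ++ l)); apply: eq_Rintegral => t _.
  by rewrite /cosprod big_cat/= -/(cosprod l t) cosprod_viete -expr2.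
have [e e0 He] := sinc_near0.
have [d d0 Hd] : exists2 d : R, 0 < d & forall t, `|t| <= d -> g 0 / 2 <= g t.
  have /cvgrPdist_lt/(_ (g 0 / 2))[|d /= d0 H] := cg 0; first by rewrite divr_gt0.
  exists (d / 2); first by rewrite divr_gt0.
  move=> t td; have /(H t) :
      `|0 - t| < d by rewrite sub0r normrN (le_lt_trans _ (half_lt _)).
  by rewrite ltr_distl => /andP[? ?]; lra.
pose G := \int[mu]_t `|g t|.
have G0 : 0 <= G by apply: Rintegral_ge0.
have main (a : R) : 0 < a -> e / a <= d -> g 0 * e * a <= 4 * G / d ^+ 2.
  move=> a0 ad; pose J : set R := `[- (e / a), e / a]%classic.
  have mJ : measurable J by exact: measurable_itv.
  have ea0 : 0 < e / a by rewrite divr_gt0.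
  have muJ : mu J = (e / a - - (e / a))%:E.
    by rewrite /J lebesgue_measure_itv/= lte_fin gtrN.
  have iJ : mu.-integrable [set: R] (EFin \o (cst (g 0 / 8) \_ J)).
    apply: (@integrable_le_bump _ _ (g 0 / 8 * (1 + (e / a) ^+ 2))).
      by apply/(measurable_restrictT _ mJ); exact: measurable_cst.
    move=> t; rewrite patchE; case: ifPn => [|_]; last first.
      by rewrite normr0 !mulr_ge0// ?invr_ge0// ?addr_ge0// ?sqr_ge0// (ltW gp).
    rewrite inE /J/= in_itv/= -ler_norml => tJ.
    rewrite ger0_norm ?divr_ge0// -mulrA ler_peMr ?divr_ge0//.
    rewrite ler_pdivlMr ?ltr_pwDl ?sqr_ge0// mul1r lerD2l.
    by rewrite -[leLHS]real_normK ?num_real// ler_sqr ?nnegrE ?(ltW ea0).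
  have iG : mu.-integrable [set: R] (EFin \o (fun t => `|g t| * (a * d) ^- 2)).
    apply: (@integrable_le_bump _ _ (C * (a * d) ^- 2)).
      by apply: measurable_funM => //; exact: measurableT_comp.
    move=> t; rewrite normrM normr_id [`|_ ^- 2|]ger0_norm ?invr_ge0 ?sqr_ge0//.
    by rewrite mulrAC ler_wpM2r// invr_ge0 sqr_ge0.
  have : \int[mu]_t ((cst (g 0 / 8) \_ J) t - `|g t| * (a * d) ^- 2) <= \int[mu]_t
      (g t * sinc (a * t) ^+ 2).
    apply: le_Rintegral => //.
    - exact: (integrableB _ iJ iG).
    - apply: (@integrable_le_bump _ _ C).
        by apply: measurable_funM => //; exact: measurable_funX.
      move=> t; rewrite normrM (le_trans _ (gC t))// ler_piMr//.
      by rewrite normrX exprn_ile1// sinc_le1.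
    move=> t _; have B0 : 0 <= `|g t| * (a * d) ^- 2.
      by rewrite mulr_ge0// invr_ge0 sqr_ge0.
    have s0 := sqr_ge0 (sinc (a * t)).
    rewrite patchE; case: ifPn => [|_].
      rewrite inE /J/= in_itv/= -ler_norml => tJ.
      have h1 := Hd t (le_trans tJ ad).
      have h2 : 4^-1 <= sinc (a * t) ^+ 2.
        by apply: He; rewrite normrM (gtr0_norm a0) mulrC -ler_pdivlMr.
      rewrite lerBlDr ler_wpDr//.
      apply: (@le_trans _ _ (g 0 / 2 * 4^-1)); first by lra.
      by apply: ler_pM => //; rewrite ?divr_ge0 ?invr_ge0.
    rewrite sub0r; have [td|td] := leP `|t| d.
      have h1 := Hd t td; rewrite (@le_trans _ _ 0) ?oppr_le0// mulr_ge0//.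
      by rewrite (le_trans _ h1)// divr_ge0.
    have t0 : t != 0 by rewrite -normr_gt0 (lt_trans d0).
    have at0 : a * t != 0 by rewrite mulf_neq0// gt_eqF.
    have h : sinc (a * t) ^+ 2 <= (a * d) ^- 2.
      have p1 : 0 < (a * t) ^+ 2 by rewrite exprn_even_gt0.
      have p2 : 0 < (a * d) ^+ 2 by rewrite exprn_gt0// mulr_gt0.
      rewrite (le_trans (sinc_sqr_le at0))// lef_pV2 ?posrE//.
      rewrite -[leRHS]real_normK ?num_real//
          ler_sqr ?nnegrE ?mulr_ge0 ?(ltW d0) ?(ltW a0)//.
      by rewrite normrM (gtr0_norm a0) ler_pM2l// ltW.
    rewrite lerNl -mulNr (@le_trans _ _ (`|g t| * sinc (a * t) ^+ 2))//.
      by rewrite ler_wpM2r// -normrN ler_norm.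
    by rewrite ler_wpM2l.
  rewrite key RintegralB// -Rintegral_mkcond Rintegral_cst// RintegralZr//;
      last exact: (integrable_norm ig).
  rewrite -/G [X in fine X](_ : _ = (e / a - - (e / a))%:E); last exact: muJ.
  rewrite /= => h.
  have aa : 0 < a ^+ 2 by rewrite exprn_gt0.
  have dd : 0 < d ^+ 2 by rewrite exprn_gt0.
  rewrite ler_pdivlMr//.
  move: h; rewrite exprMn invfM subr_le0.
  have -> : g 0 / 8 * (e / a - - (e / a)) = (g 0 * e * a / 4) / a ^+ 2.
    by field; rewrite gt_eqF.
  have -> : G * ((a ^+ 2)^-1 * (d ^+ 2)^-1) = (G / d ^+ 2) / a ^+ 2.
    by rewrite -mulrA [X in _ * X]mulrC.
  by rewrite ler_pM2r ?invr_gt0// ler_pdivlMr// => h; lra.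
(* [main] bounds [a] by [q] as soon as [e / d <= a]. *)
pose q := 4 * G / d ^+ 2 / (g 0 * e).
have q0 : 0 <= q by rewrite !divr_ge0// ?mulr_ge0// ltW// exprn_gt0.
have a0 : 0 < e / d + q + 1 by rewrite ltr_wpDl// addr_ge0// ltW// divr_gt0.
have /main := a0; rewrite ler_pdivrMr// mulrC -ler_pdivrMr//.
have ge0 : 0 < g 0 * e by rewrite mulr_gt0.
rewrite -addrA lerDl addr_ge0// => /(_ isT).
rewrite mulrC -ler_pdivlMr// -/q.
have : 0 < e / d by rewrite divr_gt0.
lra.
Qed.

End Fourier.

(** * Iterated integrals over the plane *)

Section Plane.
Context {R : realType}.
Notation mu := (@lebesgue_measure R).

(** Open sets of the plane are countable unions of rational boxes, hence belong
    to the product sigma-algebra. *)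
Lemma open_measurable_plane (U : set (R * R)) : open U -> measurable U.
Proof.
move=> oU.
pose box (q : rat * rat * nat) : set (R * R) :=
  ball (ratr q.1.1 : R) q.2.+1%:R^-1 `*` ball (ratr q.1.2 : R) q.2.+1%:R^-1.
pose B q := if `[< box q `<=` U >] then box q else set0.
have -> : U = \bigcup_q B q.
  apply/seteqP; split => [p Up|p [q _]]; last first.
    by rewrite /B; case: asboolP => // h /h.
  have /nbhs_ballP[e /= e0 pU] : nbhs p U by exact: open_nbhs_nbhs.
  have [k ke] : exists k, k.+1%:R^-1 < e / 2.
    have e2 : 0 < e / 2 by rewrite divr_gt0.
    have [N _ /(_ N (leqnn N)) h] := near_infty_natSinv_lt (PosNum e2).
    by exists N.
  have kke : k.+1%:R^-1 + k.+1%:R^-1 < e by rewrite [ltRHS]splitr ltrD.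
  have k0 : 0 < k.+1%:R^-1 :> R by rewrite invr_gt0.
  have rat_near (x : R) : exists q : rat, `|ratr q - x| < k.+1%:R^-1.
    have /rat_in_itvoo[q] : x - k.+1%:R^-1 < x + k.+1%:R^-1 by rewrite ltrBlDr -addrA
        ltrDl addr_gt0.
    by rewrite in_itv/= => qx; exists q; rewrite ltr_distl.
  have [q1 h1] := rat_near p.1; have [q2 h2] := rat_near p.2.
  exists (q1, q2, k) => //; rewrite /B; case: asboolP => [_|[]]; first by split.
  move=> z [/= z1 z2]; apply: pU.
  split; rewrite /ball/=.
    rewrite (_ : p.1 - z.1 = (ratr q1 - z.1) - (ratr q1 - p.1)); last by ring.
    by rewrite (le_lt_trans (ler_normB _ _))//; rewrite (lt_trans _ kke)// ltrD.
  rewrite (_ : p.2 - z.2 = (ratr q2 - z.2) - (ratr q2 - p.2)); last by ring.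
  by rewrite (le_lt_trans (ler_normB _ _))//; rewrite (lt_trans _ kke)// ltrD.
apply: countable_bigcupT_measurable; first exact: countableP.
move=> q; rewrite /B; case: asboolP => // _.
by apply: measurableX; exact: measurable_ball.
Qed.

Lemma continuous_measurable_plane (F : R * R -> R) : continuous F ->
  measurable_fun [set: R * R] F.
Proof.
move=> /continuousP cF; apply: (measurability _ (RGenOpens.measurableE R)).
move=> _ [_ [a [b ->] <-]]; rewrite setTI; apply: open_measurable_plane.
exact/cF/interval_open.
Qed.

Section decaying.
Variables (F : R -> R -> R) (C : R).
Hypothesis cF : continuous (fun p : R * R => F p.1 p.2).
Hypothesis FC : forall s t, `|F s t| <= C * (bump s * bump t).

Lemma continuous_section1 s : continuous (F s).
Proof.
move=> t; apply: (@continuous_comp _ _ _ (fun t => (s, t)) (fun p : R * R =>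
    F p.1 p.2)).
  exact: (@cvg_pair _ _ _ (nbhs t) (nbhs s) (nbhs t) _ _ _ (cst s) id
      (cvg_cst s) cvg_id).
exact: cF.
Qed.

Lemma continuous_section2 t : continuous (F ^~ t).
Proof.
move=> s; apply: (@continuous_comp _ _ _ (fun s => (s, t)) (fun p : R * R =>
    F p.1 p.2)).
  exact: (@cvg_pair _ _ _ (nbhs s) (nbhs s) (nbhs t) _ _ _ id (cst t) cvg_id
      (cvg_cst t)).
exact: cF.
Qed.

Lemma section1_le_bump s t : `|F s t| <= (C * bump s) * bump t.
Proof. by rewrite -mulrA. Qed.

Lemma section2_le_bump s t : `|F s t| <= (C * bump t) * bump s.
Proof. by rewrite -mulrA [bump t * _]mulrC. Qed.

Lemma decay_const_ge0 : 0 <= C.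
Proof.
have := le_trans (normr_ge0 _) (FC 0 0).
by rewrite pmulr_lge0// mulr_gt0// bump_gt0.
Qed.

Lemma section1_le_bump_unif s t : `|F s t| <= C * bump t.
Proof.
rewrite (le_trans (FC s t))// ler_wpM2l ?decay_const_ge0//.
by rewrite ler_piMl ?bump_le1// ltW// bump_gt0.
Qed.

Lemma integrable_section1 s : mu.-integrable [set: R] (EFin \o F s).
Proof.
apply: integrable_le_bump (section1_le_bump s).
by apply: continuous_measurable_fun; exact: continuous_section1.
Qed.

Lemma integrable_section2 t : mu.-integrable [set: R] (EFin \o (F ^~ t)).
Proof.
apply: (@integrable_le_bump _ _ (C * bump t)); last by move=> s;
    exact: section2_le_bump.
by apply: continuous_measurable_fun; exact: continuous_section2.
Qed.

Lemma Rintegral_section_le_bump s :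
  `|\int[mu]_t F s t| <= C * \int[mu]_t bump t * bump s.
Proof.
rewrite mulrAC; apply: Rintegral_norm_le_bump; last exact: section1_le_bump.
by apply: continuous_measurable_fun; exact: continuous_section1.
Qed.

Lemma continuous_Rintegral_section : continuous (fun s => \int[mu]_t F s t).
Proof.
move=> s.
apply: (@continuity_under_integral R _ _ mu F setT measurableT (s - 1) (s + 1) _ _
    (fun t => C * bump t)).
- by move=> r _; exact: integrable_section1.
- by apply: aeW => t _ r _; exact: continuous_section2.
- exact: (integrableZl _ _ integrable_bump).
- by move=> r _; apply: aeW => t _; exact: section1_le_bump_unif.
- by rewrite inE/= in_itv/= ltrBlDr ltrDl ltr01.
Qed.

(** Fubini's theorem for continuous functions decaying in both variables. *)
Lemma Rintegral_swap :
  \int[mu]_s \int[mu]_t F s t = \int[mu]_t \int[mu]_s F s t.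
Proof.
have E1 : (\int[mu]_s \int[mu]_t (F s t)%:E)%E = (\int[mu]_s (\int[mu]_t F s t)%:E)%E.
  apply: eq_integral => s _; rewrite /Rintegral fineK//.
  by apply: integrable_fin_num => //; exact: integrable_section1.
have E2 : (\int[mu]_t \int[mu]_s (F s t)%:E)%E = (\int[mu]_t (\int[mu]_s F s t)%:E)%E.
  apply: eq_integral => t _; rewrite /Rintegral fineK//.
  by apply: integrable_fin_num => //; exact: integrable_section2.
rewrite /Rintegral -[in LHS]E1 -[in RHS]E2; congr fine.
suff h : (mu \x mu)%E.-integrable [set: R * R] (fun p =>
    (F p.1 p.2)%:E) by exact: (Fubini h).
have mF := continuous_measurable_plane cF.
pose b (p : R * R) := C * (bump p.1 * bump p.2).
have mb : measurable_fun [set: R * R] b.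
  apply: measurable_funM => //; apply: measurable_funM.
    by apply: (measurableT_comp (continuous_measurable_fun continuous_bump)).
  by apply: (measurableT_comp (continuous_measurable_fun continuous_bump)).
have b0 p : 0 <= b p.
  by rewrite !mulr_ge0// ?decay_const_ge0// ltW// bump_gt0.
have ib : (mu \x mu)%E.-integrable [set: R * R] (EFin \o b).
  apply/integrable12ltyP; first exact/measurable_EFinP.
  have -> : (\int[mu]_x \int[mu]_y `|(EFin \o b) (x, y)|)%E =
      (\int[mu]_x (C * bump x * \int[mu]_y bump y)%:E)%E.
    apply: eq_integral => x _; rewrite -RintegralZl//; last exact: integrable_bump.
    rewrite /Rintegral fineK; last first.
      by apply: integrable_fin_num => //; exact: (integrableZl _ _ integrable_bump).
    by apply: eq_integral => y _; rewrite /= ger0_norm// /b/= mulrA.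
  have := integrableZl measurableT (C * \int[mu]_y bump y) (integrable_bump (R := R)).
  move=> /integrableP[_]; apply: le_lt_trans; rewrite le_eqVlt; apply/orP; left;
      apply/eqP.
  apply: eq_integral => x _; rewrite -EFinM /= ger0_norm 1?mulrAC//.
  by rewrite !mulr_ge0 ?decay_const_ge0 ?Rintegral_bump_ge0// ltW// bump_gt0.
apply: (le_integrable measurableT _ _ ib); first exact/measurable_EFinP.
by move=> p _; rewrite /= lee_fin [leRHS]ger0_norm.
Qed.

End decaying.
End Plane.

(** * One-forms of the plane with vanishing line integrals *)

Section PlaneDecay.
Context {R : realType}.
Notation mu := (@lebesgue_measure R).
Implicit Types (F G u : R -> R -> R).

Definition plane_continuous F := continuous (fun p : R * R => F p.1 p.2).

(** Continuous functions of the plane to which Fubini's theorem applies in the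
    form of [Rintegral_swap]. *)
Definition plane_decay F := plane_continuous F /\
  exists C, forall s t, `|F s t| <= C * (bump s * bump t).

Definition plane_integral F : R := \int[mu]_s \int[mu]_t F s t.

Lemma plane_decayM F u : plane_decay F -> plane_continuous u ->
  (forall s t, `|u s t| <= 1) -> plane_decay (fun s t => F s t * u s t).
Proof.
move=> [cF [C FC]] cu u1; split.
  by move=> p; apply: cvgM; [exact: cF|exact: cu].
by exists C => s t; rewrite normrM (le_trans _ (FC s t))// ler_piMr.
Qed.

Lemma plane_decayD F G : plane_decay F -> plane_decay G ->
  plane_decay (fun s t => F s t + G s t).
Proof.
move=> [cF [C FC]] [cG [D GD]]; split.
  by move=> p; apply: cvgD; [exact: cF|exact: cG].
by exists (C + D) => s t; rewrite (le_trans (ler_normD _ _))// mulrDl lerD.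
Qed.

Lemma plane_decayZ k F : plane_decay F -> plane_decay (fun s t => k * F s t).
Proof.
move=> [cF [C FC]]; split.
  by move=> p; apply: cvgM; [exact: cvg_cst|exact: cF].
by exists (`|k| * C) => s t; rewrite normrM -mulrA ler_wpM2l.
Qed.

Lemma plane_decay_integrable1 F s : plane_decay F ->
  mu.-integrable [set: R] (EFin \o F s).
Proof. by move=> [cF [C FC]]; exact: (integrable_section1 cF FC). Qed.

Lemma plane_decay_integrable2 F t : plane_decay F ->
  mu.-integrable [set: R] (EFin \o (F ^~ t)).
Proof. by move=> [cF [C FC]]; exact: (integrable_section2 cF FC). Qed.

Lemma plane_decay_Rintegral F : plane_decay F ->
  continuous (fun s => \int[mu]_t F s t) /\
  exists C, forall s, `|\int[mu]_t F s t| <= C * bump s.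
Proof.
move=> [cF [C FC]]; split; first exact: continuous_Rintegral_section cF FC.
by eexists; exact: Rintegral_section_le_bump cF FC.
Qed.

Lemma plane_decay_integrable F : plane_decay F ->
  mu.-integrable [set: R] (EFin \o (fun s => \int[mu]_t F s t)).
Proof.
move=> /plane_decay_Rintegral[cF [C FC]].
exact: (integrable_le_bump (continuous_measurable_fun cF) FC).
Qed.

Lemma plane_integralD F G : plane_decay F -> plane_decay G ->
  plane_integral (fun s t => F s t + G s t) = plane_integral F + plane_integral G.
Proof.
move=> dF dG; rewrite /plane_integral.
under eq_Rintegral => s _ do
  rewrite (RintegralD measurableT (plane_decay_integrable1 s dF)
      (plane_decay_integrable1 s dG)).
by rewrite RintegralD//; exact: plane_decay_integrable.
Qed.

Lemma plane_integralZ k F : plane_decay F ->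
  plane_integral (fun s t => k * F s t) = k * plane_integral F.
Proof.
move=> dF; rewrite /plane_integral.
under eq_Rintegral => s _ do
  rewrite (RintegralZl k measurableT (plane_decay_integrable1 s dF)).
by rewrite RintegralZl//; exact: plane_decay_integrable.
Qed.

Lemma plane_integral_swap F : plane_decay F ->
  plane_integral F = \int[mu]_t \int[mu]_s F s t.
Proof. by move=> [cF [C FC]]; exact: Rintegral_swap cF FC. Qed.

Lemma eq_plane_integral F G : (forall s t, F s t = G s t) ->
  plane_integral F = plane_integral G.
Proof.
by move=> FG; congr plane_integral; apply/funext => s; apply/funext => t.
Qed.

Lemma plane_continuous_linear (m1 m2 c : R) :
  plane_continuous (fun s t => m1 * s + m2 * t + c).
Proof.
move=> p; apply: cvgD; last exact: cvg_cst.
apply: cvgD; apply: cvgM; try exact: cvg_cst; [exact: cvg_fst|exact: cvg_snd].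
Qed.

Lemma plane_continuous_comp (f : R -> R) F : continuous f -> plane_continuous F ->
  plane_continuous (fun s t => f (F s t)).
Proof.
by move=> cf cF p; exact: (cvg_comp _ _ (cF p) (cf _)).
Qed.

Lemma plane_continuousM F G : plane_continuous F -> plane_continuous G ->
  plane_continuous (fun s t => F s t * G s t).
Proof. by move=> cF cG p; exact: (cvgM (cF p) (cG p)). Qed.

Lemma plane_continuous_shear k F : plane_continuous F ->
  plane_continuous (fun s t => F s (t - k * s)).
Proof.
move=> cF p.
have c1 : (fun q : R * R => q.1) @ p --> p.1 by exact: cvg_fst.
have c2 : (fun q : R * R => q.2 - k * q.1) @ p --> p.2 - k * p.1.
  have := @plane_continuous_linear (- k) 1 0 p; rewrite /=.
  rewrite (_ : (fun q => _) = (fun q : R * R => q.2 - k * q.1)); last first.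
    by apply/funext => q /=; ring.
  exact.
exact: (cvg_comp _ _ (cvg_pair c1 c2) (cF (p.1, p.2 - k * p.1))).
Qed.

Lemma plane_continuous_cos (m1 m2 c : R) :
  plane_continuous (fun s t => cos (m1 * s + m2 * t + c)).
Proof.
apply: (plane_continuous_comp (@continuous_cos R)); exact: plane_continuous_linear.
Qed.

Lemma plane_continuous_sin (m1 m2 c : R) :
  plane_continuous (fun s t => sin (m1 * s + m2 * t + c)).
Proof.
apply: (plane_continuous_comp (@continuous_sin R)); exact: plane_continuous_linear.
Qed.

Lemma cos_norm_le1 (x : R) : `|cos x| <= 1.
Proof. by rewrite ler_norml cos_geN1 cos_le1. Qed.

Lemma sin_norm_le1 (x : R) : `|sin x| <= 1.
Proof. by rewrite ler_norml sin_geN1 sin_le1. Qed.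

Lemma plane_decay_cos F (m1 m2 c : R) : plane_decay F ->
  plane_decay (fun s t => F s t * cos (m1 * s + m2 * t + c)).
Proof.
move=> dF; apply: plane_decayM => //; first exact: plane_continuous_cos.
by move=> s t; exact: cos_norm_le1.
Qed.

Lemma plane_decay_sin F (m1 m2 c : R) : plane_decay F ->
  plane_decay (fun s t => F s t * sin (m1 * s + m2 * t + c)).
Proof.
move=> dF; apply: plane_decayM => //; first exact: plane_continuous_sin.
by move=> s t; exact: sin_norm_le1.
Qed.

Lemma bump_le_inv (t : R) : 0 < t -> bump t <= t^-1.
Proof.
move=> t0; rewrite lef_pV2 ?posrE ?ltr_pwDl ?sqr_ge0//.
by have := sqr_ge0 (t - 2^-1); nra.
Qed.

Lemma cvg_le_bumpy (f : R -> R) (C : R) : (forall t, `|f t| <= C * bump t) ->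
  f t @[t --> +oo] --> 0.
Proof.
move=> fC; have C0 : 0 <= C.
  by have := le_trans (normr_ge0 _) (fC 0); rewrite pmulr_lge0// bump_gt0.
apply/cvgr0Pnorm_le => e e0; near=> t.
have t0 : 0 < t by near: t; exact: nbhs_pinfty_gt.
rewrite (le_trans (fC t))// (@le_trans _ _ (C * t^-1))//.
  by rewrite ler_wpM2l// bump_le_inv.
by rewrite ler_pdivrMr // mulrC -ler_pdivrMr.
Unshelve. all: by end_near. Qed.

Lemma cvg_le_bumpNy (f : R -> R) (C : R) : (forall t, `|f t| <= C * bump t) ->
  f t @[t --> -oo] --> 0.
Proof.
move=> fC; apply/cvgNy_compNP; apply: (@cvg_le_bumpy _ C) => t /=.
by rewrite (le_trans (fC _))// /bump sqrrN.
Qed.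

(** Integration by parts against a cosine. *)
Lemma Rintegral_derive_cos (h dh : R -> R) (C m c : R) :
  (forall t : R, is_derive t 1 h (dh t)) -> continuous dh ->
  (forall t, `|h t| <= C * bump t) -> (forall t, `|dh t| <= C * bump t) ->
  \int[mu]_t (dh t * cos (m * t + c)) = m * \int[mu]_t (h t * sin (m * t + c)).
Proof.
move=> hdh cdh hC dhC.
have ch : continuous h.
  by move=> t; apply/differentiable_continuous/derivable1_diffP/ex_derive.
have cs : continuous (fun t => sin (m * t + c)).
  by apply: continuous_comp_affine; exact: continuous_sin.
have cc : continuous (fun t => cos (m * t + c)).
  by apply: continuous_comp_affine; exact: continuous_cos.
have hsC t : `|h t * sin (m * t + c)| <= C * bump t.
  by rewrite normrM (le_trans _ (hC t))// ler_piMr// sin_norm_le1.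
have hcC t : `|h t * cos (m * t + c)| <= C * bump t.
  by rewrite normrM (le_trans _ (hC t))// ler_piMr// cos_norm_le1.
have dcC t : `|dh t * cos (m * t + c)| <= C * bump t.
  by rewrite normrM (le_trans _ (dhC t))// ler_piMr// cos_norm_le1.
have chs : continuous (fun t => h t * sin (m * t + c)).
  by move=> t; apply: cvgM; [exact: ch|exact: cs].
have cdc : continuous (fun t => dh t * cos (m * t + c)).
  by move=> t; apply: cvgM; [exact: cdh|exact: cc].
have ihs := integrable_le_bump (continuous_measurable_fun chs) hsC.
have idc := integrable_le_bump (continuous_measurable_fun cdc) dcC.
have is_derive_cos_affine (t : R) :
    is_derive t 1 (fun t => cos (m * t + c)) (- (m * sin (m * t + c))).
  have da : is_derive t 1 (fun t => m * t + c) m.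
    by apply: is_derive_eq; rewrite addr0 /GRing.scale/= mulr1.
  by apply: is_derive_eq; rewrite /GRing.scale/=; ring.
apply/eqP; rewrite -subr_eq0 -RintegralZl// -RintegralB//; last first.
  exact: (integrableZl _ _ ihs).
apply/eqP; apply: (@Rintegral_derive_eq0 _ (fun t =>
    h t * cos (m * t + c)) _ (C + `|m| * C)).
- move=> t; have H := hdh t; have H' := is_derive_cos_affine t.
  have : is_derive t 1 (h * (fun t => cos (m * t + c)))
      (h t *: (- (m * sin (m * t + c))) + cos (m * t + c) *: dh t) by exact: is_deriveM.
  by move=> /is_derive_eq; apply; rewrite /GRing.scale/=; ring.
- move=> t; apply: cvgB; first exact: cdc.
  by apply: cvgM; [exact: cvg_cst|exact: chs].
- move=> t; rewrite (le_trans (ler_normB _ _))// mulrDl lerD//.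
  by rewrite normrM -mulrA ler_wpM2l.
- exact: cvg_le_bumpy hcC.
- exact: cvg_le_bumpNy hcC.
Qed.

(** Decay in [(s, t)] persists after the shear [t |-> t - k * s]. *)
Lemma bump_shear (k s t : R) :
  bump s * bump (t - k * s) <= 2 * (1 + k ^+ 2) * bump t.
Proof.
have p (x : R) : 0 < 1 + x ^+ 2 by rewrite ltr_pwDl ?sqr_ge0.
rewrite -invfM /bump ler_pdivlMr// mulrC ler_pdivrMr ?mulr_gt0//.
set u := t - k * s; have -> : t = u + k * s by rewrite /u; ring.
have h1 := sqr_ge0 (u - k * s); have h2 := sqr_ge0 (s * u).
have h3 := sqr_ge0 k; have h4 := sqr_ge0 s; have h5 := sqr_ge0 u.
have h6 := sqr_ge0 (k * s * u); have h7 := sqr_ge0 (k * u); have h8 := sqr_ge0 (k * s).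
nra.
Qed.

(** The one-form is [a ds + b dt], with [wa] the derivative of [a] in [t] and
    [wb] that of [b] in [s].  The lines are those of direction [(1, - k)] and the
    verticals; the square on [bump s] leaves a factor [bump s] after a shear. *)
Section vanishing_on_lines.
Variables (a b wa wb : R -> R -> R) (K : R).
Hypothesis ca : plane_continuous a.
Hypothesis cb : plane_continuous b.
Hypothesis cwa : plane_continuous wa.
Hypothesis cwb : plane_continuous wb.
Hypothesis aK : forall s t, `|a s t| <= K * (bump s ^+ 2 * bump t).
Hypothesis bK : forall s t, `|b s t| <= K * (bump s ^+ 2 * bump t).
Hypothesis waK : forall s t, `|wa s t| <= K * (bump s ^+ 2 * bump t).
Hypothesis wbK : forall s t, `|wb s t| <= K * (bump s ^+ 2 * bump t).
Hypothesis da : forall s t : R, is_derive t 1 (a s) (wa s t).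
Hypothesis db : forall s t : R, is_derive s 1 (b ^~ t) (wb s t).
Hypothesis lines1 : forall k t,
  \int[mu]_s (a s (t - k * s) - k * b s (t - k * s)) = 0.
Hypothesis lines2 : forall s, \int[mu]_t b s t = 0.

Lemma decay_weaken F : plane_continuous F ->
  (forall s t, `|F s t| <= K * (bump s ^+ 2 * bump t)) ->
  forall s t, `|F s t| <= K * (bump s * bump t).
Proof.
move=> cF FK s t; rewrite (le_trans (FK s t))//.
have K0 : 0 <= K.
  have := le_trans (normr_ge0 _) (FK 0 0).
  by rewrite pmulr_lge0// mulr_gt0 ?exprn_gt0// bump_gt0.
have b0 (x : R) := ltW (bump_gt0 x).
by rewrite ler_wpM2l// ler_wpM2r// expr2 ler_piMl ?bump_le1.
Qed.

Let pd F (cF : plane_continuous F)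
  (FK : forall s t, `|F s t| <= K * (bump s ^+ 2 * bump t)) : plane_decay F.
Proof. by split => //; exists K; exact: decay_weaken. Qed.

Lemma plane_integral_wb_cos m1 m2 c :
  plane_integral (fun s t => wb s t * cos (m1 * s + m2 * t + c)) =
  m1 * plane_integral (fun s t => b s t * sin (m1 * s + m2 * t + c)).
Proof.
have dwb := pd cwb wbK; have db' := pd cb bK.
rewrite -plane_integralZ; last exact: plane_decay_sin.
rewrite plane_integral_swap; last exact: plane_decay_cos.
rewrite plane_integral_swap; last by apply: plane_decayZ; exact: plane_decay_sin.
apply: eq_Rintegral => t _.
rewrite RintegralZl//; last exact: plane_decay_integrable2 (plane_decay_sin _ _ _ db').
transitivity (\int[mu]_s (wb s t * cos (m1 * s + (m2 * t + c)))).
  by apply: eq_Rintegral => s _; rewrite addrA.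
rewrite (@Rintegral_derive_cos (b ^~ t) _ (K * bump t)).
- by congr (_ * _); apply: eq_Rintegral => s _; rewrite addrA.
- by apply: continuous_section2; exact: cwb.
- move=> s; exact: (section2_le_bump (decay_weaken cb bK)).
- move=> s; exact: (section2_le_bump (decay_weaken cwb wbK)).
Qed.

Lemma plane_integral_wa_cos m1 m2 c :
  plane_integral (fun s t => wa s t * cos (m1 * s + m2 * t + c)) =
  m2 * plane_integral (fun s t => a s t * sin (m1 * s + m2 * t + c)).
Proof.
have dwa := pd cwa waK; have da' := pd ca aK.
rewrite -plane_integralZ; last exact: plane_decay_sin.
apply: eq_Rintegral => s _.
rewrite RintegralZl//; last exact: plane_decay_integrable1 (plane_decay_sin _ _ _ da').
transitivity (\int[mu]_t (wa s t * cos (m2 * t + (m1 * s + c)))).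
  by apply: eq_Rintegral => t _; congr (_ * cos _); ring.
rewrite (@Rintegral_derive_cos (a s) _ (K * bump s)).
- by congr (_ * _); apply: eq_Rintegral => t _; congr (_ * sin _); ring.
- by apply: continuous_section1; exact: cwa.
- move=> t; exact: (section1_le_bump (decay_weaken ca aK)).
- move=> t; exact: (section1_le_bump (decay_weaken cwa waK)).
Qed.

(** The wave [sin (m1 * s + m2 * t + c)] is constant on the lines of direction
    [(1, - (m1 / m2))]; slicing the plane along these lines reduces the claim to
    the vanishing of the line integrals of the form. *)
Lemma plane_integral_wave m1 m2 c :
  m1 * plane_integral (fun s t => b s t * sin (m1 * s + m2 * t + c)) =
  m2 * plane_integral (fun s t => a s t * sin (m1 * s + m2 * t + c)).
Proof.
have da' := pd ca aK; have db' := pd cb bK.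
have [->|m20] := eqVneq m2 0.
  rewrite mul0r (_ : plane_integral _ = 0) ?mulr0//.
  rewrite /plane_integral; under eq_Rintegral => s _.
    rewrite (_ : (\int[mu]_t _) = 0); last first.
      under eq_Rintegral => t _ do rewrite mul0r addr0.
      by rewrite RintegralZr ?lines2 ?mul0r//; exact: plane_decay_integrable1.
    over.
  by rewrite Rintegral_cst// mul0r.
pose k := m1 / m2; pose g s t := a s t - k * b s t.
have dg : plane_decay g.
  rewrite (_ : g = fun s t => a s t + - k * b s t).
    by apply: plane_decayD => //; exact: plane_decayZ.
  by apply/funext => s; apply/funext => t; rewrite /g mulNr.
have gK s t : `|g s t| <= (K + `|k| * K) * (bump s ^+ 2 * bump t).
  rewrite (le_trans (ler_normB _ _))// mulrDl lerD//.
  by rewrite normrM -mulrA ler_wpM2l.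
suff G0 : plane_integral (fun s t => g s t * sin (m1 * s + m2 * t + c)) = 0.
  have : plane_integral (fun s t => a s t * sin (m1 * s + m2 * t + c) +
      - k * (b s t * sin (m1 * s + m2 * t + c))) = 0.
    by rewrite -[RHS]G0; apply: eq_plane_integral => s t; rewrite /g; ring.
  have das := plane_decay_sin m1 m2 c da'.
  have dbs := plane_decay_sin m1 m2 c db'.
  rewrite (plane_integralD das (plane_decayZ (- k) dbs)) (plane_integralZ _ dbs).
  move/eqP; rewrite mulNr subr_eq0 => /eqP ->.
  by rewrite /k mulrA mulrCA mulfV// mulr1.
pose h s t := g s (t - k * s) * sin (m2 * t + c).
have E : plane_integral (fun s t =>
    g s t * sin (m1 * s + m2 * t + c)) = plane_integral h.
  apply: eq_Rintegral => s _.
  have [cw [D wD]] := plane_decay_sin m1 m2 c dg.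
  rewrite (@Rintegral_affine _ _ (D * bump s) 1 (- (k * s)))//; first last.
  - by move=> t; rewrite -mulrA.
  - exact: (continuous_section1 cw).
  rewrite mul1r; apply: eq_Rintegral => t _; rewrite mul1r /h; congr (_ * sin _).
  by rewrite /k; field.
have dh : plane_decay h.
  split.
    apply: (plane_continuousM (F := fun s t => g s (t - k * s)) (G := fun s t =>
        sin (m2 * t + c))); first by apply: plane_continuous_shear; case: dg.
    suff -> : (fun _ t => sin (m2 * t + c)) = (fun s t => sin (0 * s + m2 * t + c)).
      exact: plane_continuous_sin.
    by apply/funext => s; apply/funext => t; rewrite mul0r add0r.
  pose D := K + `|k| * K.
  have D0 : 0 <= D.
    have := le_trans (normr_ge0 _) (gK 0 0).
    by rewrite pmulr_lge0// mulr_gt0 ?exprn_gt0// bump_gt0.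
  have b0 (x : R) := ltW (bump_gt0 x).
  exists (D * (2 * (1 + k ^+ 2))) => s t.
  rewrite /h normrM (@le_trans _ _ `|g s (t - k * s)|)//.
    by rewrite ler_piMr// sin_norm_le1.
  have H : bump s * (bump s * bump (t - k * s)) <= bump s * (2 * (1 + k ^+ 2) * bump t).
    by rewrite ler_wpM2l// bump_shear.
  rewrite (le_trans (gK _ _))// -/D.
  have -> : D * (bump s ^+ 2 * bump (t - k * s)) =
      D * (bump s * (bump s * bump (t - k * s))).
    by ring.
  have -> : D * (2 * (1 + k ^+ 2)) * (bump s * bump t) =
      D * (bump s * (2 * (1 + k ^+ 2) * bump t)).
    by ring.
  by rewrite ler_wpM2l.
rewrite E plane_integral_swap//.
under eq_Rintegral => t _.
  rewrite (_ : (\int[mu]_s _) = 0); last first.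
    rewrite /h RintegralZr//; first by rewrite lines1 mul0r.
    apply: (@integrable_le_bump _ _ (K + `|k| * K)).
      apply: continuous_measurable_fun.
      by apply: (continuous_section2 (F := fun s t => g s (t - k * s)));
          apply: plane_continuous_shear; case: dg.
    move=> s; rewrite (le_trans (gK _ _))// ler_wpM2l//.
      have := le_trans (normr_ge0 _) (gK 0 0).
      by rewrite pmulr_lge0// mulr_gt0 ?exprn_gt0// bump_gt0.
    rewrite expr2 -mulrA ler_piMr ?(ltW (bump_gt0 _))//.
    by rewrite mulr_ile1 ?(ltW (bump_gt0 _))// bump_le1.
  over.
by rewrite Rintegral_cst// mul0r.
Qed.

Lemma plane_integral_curl_cos m1 m2 c :
  plane_integral (fun s t => (wb s t - wa s t) * cos (m1 * s + m2 * t + c)) = 0.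
Proof.
have dwa := pd cwa waK; have dwb := pd cwb wbK.
transitivity (plane_integral (fun s t => wb s t * cos (m1 * s + m2 * t + c)
    + -1 * (wa s t * cos (m1 * s + m2 * t + c)))).
  by apply: eq_plane_integral => s t; ring.
rewrite plane_integralD; first last.
- by apply: plane_decayZ; exact: plane_decay_cos.
- exact: plane_decay_cos.
rewrite plane_integralZ; last exact: plane_decay_cos.
rewrite plane_integral_wb_cos plane_integral_wa_cos plane_integral_wave.
by rewrite mulN1r subrr.
Qed.

(** The curl of a decaying one-form whose line integrals vanish is zero at the
    origin: [cos_transform_eq0] is applied to its restriction to [s = 0], then to
    its cosine transforms in [t], as functions of [s]. *)
Lemma plane_form_closed : wb 0 0 = wa 0 0.
Proof.
have dwa := pd cwa waK; have dwb := pd cwb wbK.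
pose w s t := wb s t - wa s t.
have dw : plane_decay w.
  rewrite (_ : w = fun s t => wb s t + -1 * wa s t).
    by apply: plane_decayD => //; exact: plane_decayZ.
  by apply/funext => s; apply/funext => t; rewrite /w mulN1r.
apply/eqP; rewrite -subr_eq0 -/(w 0 0); apply/eqP.
have [cw [D wD]] := dw.
apply: (@cos_transform_eq0 _ (w 0) (D * bump 0)).
- exact: (continuous_section1 cw).
- by move=> t; rewrite -mulrA.
move=> m2 c2; pose G s := \int[mu]_t (w s t * cos (m2 * t + c2)).
have dG : plane_decay (fun s t => w s t * cos (m2 * t + c2)).
  suff -> : (fun s t => w s t * cos (m2 * t + c2)) =
      (fun s t => w s t * cos (0 * s + m2 * t + c2)) by exact: plane_decay_cos.
  by apply/funext => s; apply/funext => t; rewrite mul0r add0r.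
have [cG [E GE]] := plane_decay_Rintegral dG.
apply: (@cos_transform_eq0 _ G E) => // m1 c1.
have dcc : plane_decay (fun s t => w s t * cos (m2 * t + c2) * cos (m1 * s + c1)).
  suff -> : (fun s t => w s t * cos (m2 * t + c2) * cos (m1 * s + c1)) =
      (fun s t => w s t * cos (m2 * t + c2) * cos (m1 * s + 0 * t + c1)).
    exact: (plane_decay_cos _ _ _ dG).
  by apply/funext => s; apply/funext => t; rewrite mul0r addr0.
transitivity (plane_integral (fun s t =>
    w s t * cos (m2 * t + c2) * cos (m1 * s + c1))).
  apply: eq_Rintegral => s _; rewrite RintegralZr//.
  exact: (plane_decay_integrable1 s dG).
transitivity (plane_integral (fun s t =>
    2^-1 * ((w s t * cos (m1 * s + m2 * t + (c1 + c2)))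
    + w s t * cos (m1 * s + (- m2) * t + (c1 - c2))))).
  apply: eq_plane_integral => s t.
  have -> : m1 * s + m2 * t + (c1 + c2) = (m1 * s + c1) + (m2 * t + c2) by ring.
  have -> : m1 * s + - m2 * t + (c1 - c2) = (m1 * s + c1) - (m2 * t + c2) by ring.
  by move: (m1 * s + c1) (m2 * t + c2) => A B; rewrite cosB cosD; field.
rewrite plane_integralZ; last first.
  by apply: plane_decayD; exact: plane_decay_cos.
rewrite plane_integralD; [|exact: plane_decay_cos|exact: plane_decay_cos].
by rewrite !plane_integral_curl_cos addr0 mulr0.
Qed.

End vanishing_on_lines.
End PlaneDecay.
(** * Differential calculus in coordinates *)

Section Calculus.
Context {R : realType} {n : nat}.
Implicit Types (x y u v : 'rV[R]_n) (g : 'rV[R]_n -> R).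

Lemma coord_le_norm x i : `|x 0 i| <= `|x|.
Proof.
rewrite [leRHS]/Num.norm/= mx_normrE.
exact: (le_bigmax _ (fun ij => `|x ij.1 ij.2|) (0, i)).
Qed.

Lemma norm_le_coord x (M : R) : 0 <= M -> (forall i, `|x 0 i| <= M) -> `|x| <= M.
Proof.
move=> M0 h; rewrite /Num.norm/= mx_normrE; apply/bigmax_leP; split=> // -[i j] _.
by rewrite /= ord1.
Qed.

(** Existence everywhere and continuity of the first partial derivatives. *)
Definition C1 g := forall i : 'I_n,
  (forall x, derivable g x (delta_mx 0 i)) /\ continuous (partial i g).

Lemma is_derive_line g x v (s : R) : derivable g (x + s *: v) v ->
  is_derive s 1 (fun s : R => g (x + s *: v)) ('D_v g (x + s *: v)).
Proof.
move=> d.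
have E : (fun h : R => h^-1 *: (((fun s : R =>
    g (x + s *: v)) \o shift s) (h *: 1) - g (x + s *: v)))
    = (fun h : R => h^-1 *: ((g \o shift (x + s *: v)) (h *: v) - g (x + s *: v))).
  apply/funext => h /=; congr (_ *: (g _ - _)).
  have -> : h *: (1 : R) = h by rewrite /GRing.scale/= mulr1.
  by rewrite scalerDl addrCA.
split; first by rewrite /derivable E.
by rewrite /derive E.
Qed.

Lemma is_derive_partial g x i (s : R) : C1 g ->
  is_derive s 1 (fun s : R =>
      g (x + s *: delta_mx 0 i)) (partial i g (x + s *: delta_mx 0 i)).
Proof. by move=> Cg; apply: is_derive_line; case: (Cg i). Qed.

(** Mean value theorem along one coordinate. *)
Lemma partial_MVT g x i (a : R) : C1 g -> exists c : R, `|c| <= `|a| /\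
  g (x + a *: delta_mx 0 i) - g x = a * partial i g (x + c *: delta_mx 0 i).
Proof.
move=> Cg; pose e : 'rV[R]_n := delta_mx 0 i.
pose G (s : R) := g (x + (a * s) *: e).
have dG (s : R) : is_derive s 1 G (a * partial i g (x + (a * s) *: e)).
  have d1 : is_derive s 1 (fun s => a * s) a.
    by apply: is_derive_eq; rewrite /GRing.scale/= mulr1.
  have d2 := is_derive_partial x i (a * s) Cg.
  by rewrite [X in is_derive _ _ _ X]mulrC; exact: (is_derive1_comp d2 d1).
have [s s01] : exists2 s : R, s \in `[0, 1] &
    G 1 - G 0 = a * partial i g (x + (a * s) *: e) * (1 - 0).
  apply: (@MVT_segment _ G (fun s => a * partial i g (x + (a * s) *: e)) 0 1) => //.
  apply: continuous_subspaceT => s.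
  by apply/differentiable_continuous/derivable1_diffP; case: (dG s).
rewrite subr0 mulr1 /G mulr1 mulr0 scale0r addr0 => ->.
exists (a * s); split => //; rewrite normrM ler_piMr//.
by move: s01; rewrite in_itv/= => /andP[s0 s1]; rewrite ger0_norm.
Qed.

(** Mean value theorem in all coordinates, changing one coordinate at a time,
    with one intermediate point for each coordinate. *)
Lemma multi_MVT g x u : C1 g -> exists c : 'I_n -> 'rV[R]_n,
  (forall k, `|c k - x| <= `|u|) /\
  g (x + u) - g x = \sum_(k < n) u 0 k * partial k g (c k).
Proof.
move=> Cg.
(* [T m] keeps the first [m] coordinates of [u]. *)
pose T (m : nat) : 'rV[R]_n := \row_j (if (j < m)%N then u 0 j else 0).
have TS (k : 'I_n) : T k.+1 = T k + u 0 k *: delta_mx 0 k.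
  apply/rowP => j; rewrite !mxE eqxx/= ltnS leq_eqVlt.
  have [->|jk] := eqVneq j k; first by rewrite eqxx ltnn/= mulr1 add0r.
  by rewrite (negbTE (jk : (j : nat) != k)) /= mulr0 addr0.
have /choice[c Hc] : forall k : 'I_n, exists c, `|c - x| <= `|u| /\
    g (x + T k.+1) - g (x + T k) = u 0 k * partial k g c.
  move=> k; have [c [cu E]] := partial_MVT (x + T k) k (u 0 k) Cg.
  exists (x + T k + c *: delta_mx 0 k); split; last by rewrite TS addrA.
  rewrite addrAC [x + _]addrC addrK addrC; apply: norm_le_coord => // j.
  rewrite !mxE eqxx/=; have [->|jk] := eqVneq j k.
    by rewrite ltnn addr0 mulr1 (le_trans cu)// coord_le_norm.
  by rewrite mulr0 add0r; case: ifP => _; rewrite ?normr0// coord_le_norm.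
exists c; split; first by move=> k; case: (Hc k).
rewrite (eq_bigr (fun k : 'I_n => g (x + T k.+1) - g (x + T k))); last first.
  by move=> k _; case: (Hc k).
rewrite -(big_mkord xpredT (fun k => g (x + T k.+1) - g (x + T k))) telescope_sumr//.
congr (g _ - g _).
  by congr (_ + _); apply/rowP => j; rewrite mxE ltn_ord.
by rewrite (_ : T 0%N = 0) ?addr0//; apply/rowP => j; rewrite !mxE ltn0.
Qed.

Lemma cvg_sumr (T I : Type) (F : set_system T) (FF : Filter F) (r : seq I)
    (f : I -> T -> R) (l : I -> R) :
  (forall i, f i t @[t --> F] --> l i) ->
  \sum_(i <- r) f i t @[t --> F] --> \sum_(i <- r) l i.
Proof.
move=> fl; elim: r => [|i r IH].
  by rewrite big_nil; under eq_fun do rewrite big_nil; exact: cvg_cst.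
rewrite big_cons; under eq_fun do rewrite big_cons.
by apply: cvgD => //; exact: fl.
Qed.

(** A directional derivative of a [C1] function is linear in the direction. *)
Lemma C1_directional g x v : C1 g ->
  derivable g x v /\ 'D_v g x = \sum_(i < n) v 0 i * partial i g x.
Proof.
move=> Cg.
have /choice[c Hc] : forall h : R, exists c : 'I_n -> 'rV[R]_n,
  (forall k, `|c k - x| <= `|h *: v|) /\
  g (x + h *: v) - g x = \sum_(k < n) (h *: v) 0 k * partial k g (c k).
  by move=> h; exact: multi_MVT.
have cx k : c h k @[h --> (0 : R)^'] --> x.
  apply/cvgrPdist_le => e e0; near=> h.
  rewrite distrC (le_trans ((Hc h).1 k))// normrZ.
  apply: (@le_trans _ _ (e / (`|v| + 1) * (`|v| + 1)));
      last by rewrite divfK// gt_eqF// ltr_wpDl.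
  apply: ler_pM => //; last by rewrite lerDl.
  by near: h; apply: dnbhs0_le; rewrite divr_gt0// ltr_wpDl.
have L : h^-1 *: ((g \o shift x) (h *: v) - g x) @[h --> (0 : R)^'] -->
    \sum_(i < n) v 0 i * partial i g x.
  have : \sum_(i < n) v 0 i * partial i g (c h i) @[h --> (0 : R)^'] -->
      \sum_(i < n) v 0 i * partial i g x.
    apply: cvg_sumr => i; apply: cvgM; first exact: cvg_cst.
    exact: (cvg_comp _ _ (cx i) ((Cg i).2 x)).
  apply: cvg_trans; apply: near_eq_cvg; near=> h.
  have h0 : h != 0 by near: h; exact: nbhs_dnbhs_neq.
  rewrite /= [h *: v + x]addrC (Hc h).2 scaler_sumr; apply: eq_bigr => k _.
  by rewrite mxE /GRing.scale/= !mulrA mulVf// mul1r.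
split; first exact: cvgP L.
exact: cvg_lim L.
Unshelve. all: by end_near. Qed.

Lemma C1_is_derive g x v (s : R) : C1 g ->
  is_derive s 1 (fun s : R =>
      g (x + s *: v)) (\sum_(i < n) v 0 i * partial i g (x + s *: v)).
Proof.
move=> Cg; have [d e] := C1_directional (x + s *: v) v Cg.
by rewrite -e; exact: is_derive_line.
Qed.

Lemma smooth_C1 g s : smooth g -> C1 (iter_partial s g).
Proof.
move=> sg i; split; first by move=> x; exact: (sg s).2.
exact: (sg (i :: s)).1.
Qed.

End Calculus.

(** * Decay of Schwartz functions along lines and planes *)

Section SchwartzBounds.
Context {R : realType} {n : nat}.
Implicit Types (x y u v : 'rV[R]_n) (g : 'rV[R]_n -> R).

Lemma norm_coord x : x != 0 -> exists i, `|x| = `|x 0 i|.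
Proof.
move=> x0; have : mx_norm x != 0 by rewrite -[mx_norm x]/`|x| normr_eq0.
by move/mx_norm_neq0 => [[i j]] /= e; exists j; rewrite [LHS]e ord1.
Qed.

Lemma exprD1_le (m : R) N : 0 <= m -> (1 + m) ^+ N <= 2 ^+ N * (1 + m ^+ N).
Proof.
move=> m0; have p2 : (0 : R) <= 2 ^+ N by rewrite exprn_ge0.
have [m1|m1] := leP m 1.
  rewrite (@le_trans _ _ (2 ^+ N))//; last by rewrite ler_peMr// lerDl exprn_ge0.
  by rewrite lerXn2r ?nnegrE ?addr_ge0//; lra.
rewrite (@le_trans _ _ ((2 * m) ^+ N))//.
  by rewrite lerXn2r ?nnegrE ?addr_ge0 ?mulr_ge0//; lra.
by rewrite exprMn ler_wpM2l// lerDr.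
Qed.

Lemma schwartz_decay g s N : schwartz g ->
  exists C, forall x, (1 + `|x|) ^+ N * `|iter_partial s g x| <= C.
Proof.
move=> [_ sg]; have [C0 H0] := sg (fun=> 0%N) s.
have /choice[C HC] : forall i : 'I_n, exists C, forall x,
    `|x 0 i| ^+ N * `|iter_partial s g x| <= C.
  move=> i; have [C HC] := sg (fun j => if j == i then N else 0%N) s.
  exists C => x; rewrite (le_trans _ (HC x))// normrM -normrX.
  rewrite (bigD1 i)//= eqxx big1 ?mulr1// => j /negbTE ->.
  by rewrite expr0.
have C00 : 0 <= C0 by rewrite (le_trans _ (H0 0)).
have Ci0 i : 0 <= C i by rewrite (le_trans _ (HC i 0))// mulr_ge0// exprn_ge0.
exists (2 ^+ N * (C0 + (C0 + \sum_i C i))) => x.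
have H0' y : `|iter_partial s g y| <= C0.
  by rewrite (le_trans _ (H0 y))// big1 ?mul1r// => i _; rewrite expr0.
apply: (@le_trans _ _ (2 ^+ N * (1 + `|x| ^+ N) * `|iter_partial s g x|)).
  by rewrite ler_wpM2r// exprD1_le.
rewrite -mulrA ler_wpM2l ?exprn_ge0// mulrDl mul1r lerD//.
have [->|x0] := eqVneq x 0.
  rewrite normr0 (@le_trans _ _ C0)//; last by rewrite lerDl sumr_ge0.
  by rewrite (le_trans _ (H0' 0))// ler_piMl// exprn_ile1.
have [i ->] := norm_coord x0.
rewrite (le_trans (HC i x))// (bigD1 i)//= addrCA lerDl addr_ge0// sumr_ge0//.
Qed.

Lemma schwartz_decay_shift g s N x : schwartz g ->
  exists2 C, 0 <= C & forall h, (1 + `|h|) ^+ N * `|iter_partial s g (x + h)| <= C.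
Proof.
move=> /(schwartz_decay s N)[C HC].
have C0 : 0 <= C by rewrite (le_trans _ (HC 0))// mulr_ge0// exprn_ge0// addr_ge0.
exists ((1 + `|x|) ^+ N * C) => [|h]; first by rewrite mulr_ge0// exprn_ge0// addr_ge0.
apply: (@le_trans _ _ ((1 + `|x|) ^+ N * ((1 + `|x + h|) ^+ N * `|iter_partial s g
    (x + h)|))); last first.
  by rewrite ler_wpM2l// exprn_ge0// addr_ge0.
rewrite mulrA ler_wpM2r// -exprMn lerXn2r ?nnegrE ?mulr_ge0 ?addr_ge0//.
have : `|h| <= `|x| + `|x + h|.
  by rewrite -{1}[h](addKr x) (le_trans (ler_normD _ _))// normrN.
have := normr_ge0 x; have := normr_ge0 (x + h); have := normr_ge0 h.
by move: `|x| `|x + h| `|h| => A B D *; nra.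
Qed.

(** Decay of a Schwartz function and of its derivatives along a line. *)
Lemma schwartz_line g s x v : schwartz g -> v != 0 ->
  exists C, forall t : R, `|iter_partial s g (x + t *: v)| <= C * bump t.
Proof.
move=> sg v0; have [C C0 HC] := schwartz_decay_shift s 2 x sg.
have nv : 0 < `|v| by rewrite normr_gt0.
exists (C * (1 + `|v| ^- 2)) => t.
have := HC (t *: v); rewrite normrZ;
    move: `|iter_partial _ _ _| (normr_ge0 (iter_partial s g (x + t *: v))) => D D0 H.
have p : 0 < 1 + t ^+ 2 by rewrite ltr_pwDl ?sqr_ge0.
rewrite /bump ler_pdivlMr//.
apply: (@le_trans _ _ ((1 + `|v| ^- 2) * ((1 + `|t| * `|v|) ^+ 2 * D))); last first.
  by rewrite mulrC ler_wpM2r// addr_ge0// invr_ge0 sqr_ge0.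
rewrite mulrC mulrA ler_wpM2r//.
have e : t ^+ 2 = `|v| ^- 2 * (`|t| * `|v|) ^+ 2.
  by rewrite exprMn real_normK ?num_real// mulrCA mulVf ?mulr1// expf_neq0// gt_eqF.
rewrite e; have : 0 <= `|v| ^- 2 by rewrite invr_ge0 sqr_ge0.
have : 0 <= `|t| * `|v| by rewrite mulr_ge0.
move: (`|v| ^- 2) (`|t| * `|v|) => A B B0 A0.
have AB : 0 <= A * B by rewrite mulr_ge0.
have := sqr_ge0 B.
nra.
Qed.

(** Decay of a Schwartz function and of its derivatives along a plane parallel to
    two axes. *)
Lemma schwartz_plane g s x (j k : 'I_n) : schwartz g -> j != k ->
  exists2 C, 0 <= C & forall a b : R,
    `|iter_partial s g (x + (a *: delta_mx 0 j + b *: delta_mx 0 k))| <=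
    C * (bump a ^+ 2 * bump b).
Proof.
move=> sg jk; have [C C0 HC] := schwartz_decay_shift s 6 x sg.
exists C => // a b; have := HC (a *: delta_mx 0 j + b *: delta_mx 0 k).
set h := a *: _ + b *: _.
have ha : `|a| <= `|h|.
  have := coord_le_norm h j; rewrite !mxE !eqxx/= (negbTE jk) mulr1 mulr0 addr0.
  exact.
have hb : `|b| <= `|h|.
  have := coord_le_norm h k; rewrite !mxE !eqxx/= eq_sym (negbTE jk) mulr1 mulr0 add0r.
  exact.
move: `|iter_partial _ _ _| (normr_ge0 (iter_partial s g (x + h))) => D D0 H.
have p (t : R) : 0 < 1 + t ^+ 2 by rewrite ltr_pwDl ?sqr_ge0.
rewrite /bump exprVn -invfM ler_pdivlMr ?mulr_gt0 ?exprn_gt0//.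
apply: le_trans H; rewrite mulrC ler_wpM2r//.
have q (t : R) : `|t| <= `|h| -> 1 + t ^+ 2 <= (1 + `|h|) ^+ 2.
  rewrite -(ler_sqr) ?nnegrE// real_normK ?num_real// => th.
  by have := normr_ge0 h; move: th; move: `|h| => B; nra.
rewrite (_ : 6 = 2 * 2 + 2)%N// exprD exprM.
have pb : 0 <= 1 + b ^+ 2 := ltW (p b).
have pa : 0 <= (1 + a ^+ 2) ^+ 2 by rewrite exprn_ge0// ltW.
apply: ler_pM => //; last exact: q.
by rewrite lerXn2r ?nnegrE ?exprn_ge0 ?(ltW (p _)) ?addr_ge0//; exact: q.
Qed.

Lemma schwartz_norm_decay g N : schwartz g ->
  exists C, forall x, `|x| ^+ N * `|g x| <= C.
Proof.
move=> /(schwartz_decay [::] N)[C HC]; exists C => x.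
rewrite (le_trans _ (HC x))// ler_wpM2r// lerXn2r ?nnegrE ?addr_ge0//.
by rewrite lerDr.
Qed.

End SchwartzBounds.

(** * Potentials of closed one-forms *)

Section Potential.
Context {R : realType} {n : nat}.
Notation mu := (@lebesgue_measure R).
Implicit Types (x y u v : 'rV[R]_n) (g : 'rV[R]_n -> R).

(** Converse of [is_derive_line] at the origin of the line. *)
Lemma derivable_line g x v (d : R) : is_derive (0 : R) 1 (fun s : R =>
    g (x + s *: v)) d ->
  derivable g x v /\ 'D_v g x = d.
Proof.
move=> [].
have E : (fun h : R => h^-1 *: (((fun s : R =>
    g (x + s *: v)) \o shift 0) (h *: 1) - g (x + 0 *: v)))
    = (fun h : R => h^-1 *: ((g \o shift x) (h *: v) - g x)).
  apply/funext => h /=; rewrite scale0r !addr0; congr (_ *: (g _ - _)).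
  have -> : h *: (1 : R) = h by rewrite /GRing.scale/= mulr1.
  by rewrite addrC.
by rewrite /derivable /derive E.
Qed.

(** Continuity of [C1] functions, along an arbitrary filter. *)
Lemma C1_cvg g x (F : set_system 'rV[R]_n) (FF : Filter F) : C1 g ->
  (y : 'rV[R]_n) @[y --> F] --> x -> g y @[y --> F] --> g x.
Proof.
move=> Cg Fx.
have /choice[c Hc] : forall y, exists c : 'I_n -> 'rV[R]_n,
  (forall k, `|c k - x| <= `|y - x|) /\
  g (x + (y - x)) - g x = \sum_(k < n) (y - x) 0 k * partial k g (c k).
  by move=> y; exact: multi_MVT.
have cx k : c y k @[y --> F] --> x.
  apply/cvgrPdist_le => e e0; move/cvgrPdist_le : (Fx) => /(_ e e0).
  by apply: filterS => y xy; rewrite distrC (le_trans ((Hc y).1 k))// distrC.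
have h : \sum_(k < n) (y - x) 0 k * partial k g (c y k) @[y --> F] -->
    \sum_(k < n) (0 : R) * partial k g x.
  apply: cvg_sumr => k; apply: cvgM; last exact: (cvg_comp _ _ (cx k) ((Cg k).2 x)).
  have : (y : 'rV[R]_n) 0 k - x 0 k @[y --> F] --> x 0 k - x 0 k.
    by apply: cvgB; [exact: (cvg_comp _ _ Fx
        (@coord_continuous _ _ _ 0 k x))|exact: cvg_cst].
  rewrite subrr; apply: cvg_trans; apply: near_eq_cvg; apply: nearW => y.
  by rewrite !mxE.
move: h; rewrite big1; last by move=> k _; rewrite mul0r.
move=> h; apply/subr_cvg0; apply: cvg_trans h; apply: near_eq_cvg; apply: nearW => y.
by rewrite -(Hc y).2 [x + (y - x)]addrC subrK.
Qed.

Lemma C1_continuous g : C1 g -> continuous g.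
Proof. by move=> Cg x; apply: (@C1_cvg g x (nbhs x) (nbhs_filter x)) => //;
    exact: cvg_id. Qed.

(** Mean value theorem along a segment. *)
Lemma segment_MVT g y u : C1 g -> exists2 s : R, 0 <= s <= 1 &
  g (y + u) - g y = \sum_(i < n) u 0 i * partial i g (y + s *: u).
Proof.
move=> Cg; pose G (s : R) := g (y + s *: u).
have dG (s : R) : is_derive s 1 G (\sum_(i < n) u 0 i * partial i g (y + s *: u)).
  exact: C1_is_derive.
have [s s01] : exists2 s : R, s \in `[0, 1] &
    G 1 - G 0 = (\sum_(i < n) u 0 i * partial i g (y + s *: u)) * (1 - 0).
  apply: (@MVT_segment _ G (fun s =>
      \sum_(i < n) u 0 i * partial i g (y + s *: u)) 0 1) => //.
  apply: continuous_subspaceT => s.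
  by apply/differentiable_continuous/derivable1_diffP; case: (dG s).
rewrite subr0 mulr1 /G scale1r scale0r addr0 => ->.
by exists s => //; move: s01; rewrite in_itv.
Qed.

Lemma continuous_bounded_ball g (r : R) : continuous g ->
  exists M, forall x, `|x| <= r -> `|g x| <= M.
Proof.
move=> cg; have [r0|r0] := ltP r 0.
  by exists 0 => x xr; have := lt_le_trans r0 (normr_ge0 x); rewrite ltNge xr.
pose A := [set x : 'rV[R]_n | `|x| <= r].
have cA : compact A.
  apply: bounded_closed_compact.
    by exists r; split; [exact: num_real|move=> M rM x /= xr;
        rewrite (le_trans xr)// ltW].
  rewrite (_ : A = Num.norm @^-1` [set t : R | t <= r])//.
  by apply: closed_comp; [move=> x _; exact: norm_continuous|exact: closed_le].
have A0 : A !=set0 by exists 0; rewrite /A/= normr0.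
have cn : {within A, continuous (fun x => `|g x|)}.
  apply: continuous_subspaceT => x.
  exact: (cvg_comp _ _ (cg x) (@norm_continuous _ _ (g x))).
have [c _ H] := EVT_max_rV A0 cA cn.
by exists `|g c| => x xr; apply: H; rewrite inE.
Qed.

Lemma sumr_const_le (F : 'I_n -> R) (M : R) : (forall i, F i <= M) ->
  \sum_i F i <= n%:R * M.
Proof.
move=> FM; rewrite (le_trans (ler_sum _ (fun i _ => FM i)))//.
by rewrite sumr_const card_ord mulr_natl.
Qed.

Section closed_form.
Variable w : 'I_n -> 'rV[R]_n -> R.
Hypothesis Cw : forall i, C1 (w i).
Hypothesis closed_w : forall i j x, partial i (w j) x = partial j (w i) x.

(** The integral of the one-form [w] over the segment from the origin to [x]. *)
Definition radial_potential x : R :=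
  \int[mu]_(t in `[0, 1]) \sum_(i < n) x 0 i * w i (t *: x).

Let e (k : 'I_n) : 'rV[R]_n := delta_mx 0 k.

(** Poincare lemma: by closedness, the derivative of the integrand in direction
    [k] is the derivative of [t * w k (t *: x)] in [t]. *)
Lemma radial_potential_derive k x :
  derivable radial_potential x (e k) /\ partial k radial_potential x = w k x.
Proof.
apply: derivable_line.
pose f (s t : R) : R := \sum_(i < n) (x + s *: e k) 0 i * w i (t *: (x + s *: e k)).
pose df (s t : R) : R := w k (t *: (x + s *: e k)) +
  t * \sum_(i < n) (x + s *: e k) 0 i * partial k (w i) (t *: (x + s *: e k)).
have dw i (s t : R) : is_derive s 1 (fun s : R => w i (t *: (x + s *: e k)))
    (t * partial k (w i) (t *: (x + s *: e k))).
  have d1 : is_derive s 1 (fun s : R => t * s) t.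
    by apply: is_derive_eq; rewrite /GRing.scale/= mulr1.
  have d2 := is_derive_partial (t *: x) k (t * s) (Cw i).
  have := is_derive1_comp d2 d1; rewrite mulrC -scalerA -scalerDr.
  rewrite (_ : _ \o _ = (fun s : R => w i (t *: (x + s *: e k))))//.
  by apply/funext => r /=; rewrite -scalerA -scalerDr.
have dx i (s : R) : is_derive s 1 (fun s : R => (x + s *: e k) 0 i) ((i == k)%:R : R).
  rewrite (_ : (fun s : R => _) = (fun s => (i == k)%:R * s + x 0 i)).
    by apply: is_derive_eq; rewrite addr0 /GRing.scale/= mulr1.
  by apply/funext => r; rewrite !mxE eqxx mulrC addrC.
have dfE (s t : R) : is_derive s 1 (f ^~ t) (df s t).
  rewrite (_ : f ^~ t = \sum_(i < n) (fun s =>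
      (x + s *: e k) 0 i * w i (t *: (x + s *: e k)))); last first.
    by apply/funext => r; rewrite fct_sumE.
  have di i : is_derive s 1 (fun s => (x + s *: e k) 0 i * w i (t *: (x + s *: e k)))
      ((x + s *: e k) 0 i *: (t * partial k (w i) (t *: (x + s *: e k))) +
       w i (t *: (x + s *: e k)) *: (i == k)%:R).
    exact: is_deriveM.
  apply: is_derive_eq; rewrite big_split/= addrC /df; congr (_ + _).
    rewrite (bigD1 k)//= eqxx big1 ?addr0 /GRing.scale/= ?mulr1// => i /negbTE ->.
    by rewrite mulr0.
  by rewrite mulr_sumr; apply: eq_bigr => i _; rewrite /GRing.scale/= mulrCA.
have cscale y : continuous (fun t : R => t *: y).
  by move=> t; apply: cvgZr_tmp; exact: cvg_id.
have cf (s : R) : continuous (f s).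
  move=> t; apply: cvg_sumr => i; apply: cvgM; first exact: cvg_cst.
  exact: (cvg_comp _ _ (cscale (x + s *: e k) t) (@C1_continuous (w i) (Cw i) _)).
have [M HM] : exists M : R, forall s t : R, `|s| <= 1 -> 0 <= t <= 1 -> `|df s t| <= M.
  have [M0 H0] := continuous_bounded_ball (`|x| + 1) (C1_continuous (Cw k)).
  have /choice[M1 H1] : forall i, exists M, forall y, `|y| <= `|x| + 1 -> `|partial k
      (w i) y| <= M.
    by move=> i; apply: continuous_bounded_ball; case: (Cw i k).
  have M10 i : 0 <= M1 i by rewrite (le_trans _ (H1 i 0 _))// normr0 addr_ge0.
  exists (M0 + \sum_i (`|x| + 1) * M1 i) => s t s1 /andP[t0 t1].
  have ne : `|e k| <= 1.
    by apply: norm_le_coord => // i; rewrite mxE eqxx/=; case: eqP => _;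
        rewrite ?normr1 ?normr0.
  have nx : `|x + s *: e k| <= `|x| + 1.
    by rewrite (le_trans (ler_normD _ _))// lerD2l normrZ mulr_ile1.
  have ntx : `|t *: (x + s *: e k)| <= `|x| + 1.
    by rewrite normrZ (ger0_norm t0) (le_trans _ nx)// ler_piMl.
  rewrite /df (le_trans (ler_normD _ _))// lerD ?H0//.
  rewrite normrM (ger0_norm t0) (le_trans (ler_piMl _ t1))//.
  rewrite (le_trans (ler_norm_sum _ _ _))// ler_sum// => i _.
  rewrite normrM ler_pM// ?H1//.
  by rewrite (le_trans (coord_le_norm _ _)).
have M0 : 0 <= M by rewrite (le_trans _ (HM 0 0 _ _))// ?normr0// lexx ler01.
have intf (s : R) : mu.-integrable `[0, 1] (EFin \o f s).
  apply: continuous_compact_integrable; first exact: segment_compact.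
  exact: continuous_subspaceT.
have I0 : `]-1, 1[%classic (0 : R) by rewrite /= in_itv/= ltrN10 ltr01.
have derf (s t : R) : `]-1, 1[%classic s -> `[0, 1]%classic t -> derivable (f ^~ t) s 1.
  by move=> _ _; case: (dfE s t).
have intM : mu.-integrable `[0, 1] (EFin \o (fun _ : R => M)).
  apply: continuous_compact_integrable; first exact: segment_compact.
  by apply: continuous_subspaceT => t; exact: cvg_cst.
have dub (s t : R) : `]-1, 1[%classic s -> `[0, 1]%classic t -> `|partial1of2 f s t|
    <= M.
  rewrite /= !in_itv/= => /andP[s1 s2] t01.
  rewrite partial1of2E (@derive_val _ _ _ _ _ _ _ (dfE s t)).
  by apply: HM => //; rewrite ler_norml !ltW.
have d := derivable_under_integral (mu := mu) (measurable_itv _) I0 (fun s _ =>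
    intf s) derf (fun _ => M0) intM dub.
have v := differentiation_under_integral (mu := mu) (measurable_itv _) I0
    (fun s _ => intf s) derf (fun _ => M0) intM dub.
apply: DeriveDef => //; rewrite -derive1E v.
have -> : \int[mu]_(t in `[0, 1]) partial1of2 f 0 t =
    \int[mu]_(t in `[0, 1]) (w k (t *: x) + t * \sum_(i < n) x 0 i * partial i
        (w k) (t *: x)).
  apply: eq_Rintegral => t _; rewrite partial1of2E.
  rewrite (@derive_val _ _ _ _ _ _ _ (dfE 0 t)).
  rewrite /df scale0r addr0; congr (_ + _ * _); apply: eq_bigr => i _.
  by rewrite closed_w.
pose F (t : R) := t * w k (t *: x).
have dF (t : R) : is_derive t 1 F (w k
    (t *: x) + t * \sum_(i < n) x 0 i * partial i (w k) (t *: x)).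
  have dl := C1_is_derive 0 x t (Cw k).
  have d' : is_derive t 1 (fun t =>
      w k (t *: x)) (\sum_(i < n) x 0 i * partial i (w k) (t *: x)).
    move: dl; rewrite add0r (_ : (fun s : R => _) = (fun t => w k (t *: x)))//.
    by apply/funext => r; rewrite add0r.
  have : is_derive t 1 (id * (fun t => w k (t *: x)))
      (t *: (\sum_(i < n) x 0 i * partial i (w k) (t *: x)) + w k (t *: x) *: (1 : R)).
    exact: is_deriveM.
  by move=> /is_derive_eq; apply; rewrite /GRing.scale/= mulr1 addrC.
rewrite /Rintegral (@continuous_FTC2 _ _ F)//.
- by rewrite /F mul0r mul1r scale1r sube0.
- apply: continuous_subspaceT => t; apply: cvgD.
    exact: (cvg_comp _ _ (cscale x t) (@C1_continuous (w k) (Cw k) _)).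
  apply: cvgM; first exact: cvg_id.
  apply: cvg_sumr => i; apply: cvgM; first exact: cvg_cst.
  exact: (cvg_comp _ _ (cscale x t) ((Cw k i).2 _)).
- have cF : continuous F.
    by move=> t; apply/differentiable_continuous/derivable1_diffP; case: (dF t).
  split => [t _||]; first by case: (dF t).
  + by apply: cvg_at_right_filter; exact: cF.
  + by apply: cvg_at_left_filter; exact: cF.
- by move=> t _; rewrite derive1E; case: (dF t).
Qed.

End closed_form.
End Potential.

(** * Potentials of decaying closed one-forms *)

Section DecayingPotential.
Context {R : realType}.

(** A function whose derivative decays like [r ^- N.+2] for positive [r]
    approaches a limit at the rate [r ^- N.+1]. *)
Lemma derive_decay_limit (h dh : R -> R) (A : R) N :
  (forall r : R, is_derive r 1 h (dh r)) ->
  (forall r, 0 < r -> r ^+ N.+2 * `|dh r| <= A) ->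
  exists L, forall r, 0 < r -> r ^+ N.+1 * `|h r - L| <= A.
Proof.
move=> dhh dhA.
have A0 : 0 <= A by rewrite (le_trans _ (dhA 1 ltr01))// mulr_ge0// exprn_ge0.
pose q (r : R) := A * r ^- N.+1.
have dq (r : R) : 0 < r -> is_derive r 1 q (- (A * N.+1%:R) * r ^- N.+2).
  move=> r0; have rn : r ^+ N.+1 != 0 by rewrite expf_neq0// gt_eqF.
  have d1 : is_derive r 1 (fun r => r ^+ N.+1) (N.+1%:R * r ^+ N).
    have : is_derive r 1 ((id : R -> R) ^+ N.+1) ((N.+1%:R * r ^+ N) *: (1 :
        R)) by exact: is_deriveX.
    by rewrite /GRing.scale/= mulr1 exprfctE.
  have d2 : is_derive r 1 (fun r =>
      (r ^+ N.+1)^-1) (- (r ^+ N.+1) ^- 2 *: (N.+1%:R * r ^+ N)).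
    exact: is_deriveV.
  have d3 : is_derive r 1 q (A *: (- (r ^+ N.+1) ^- 2 *: (N.+1%:R * r ^+ N))).
    exact: is_deriveZ.
  move: d3 => /is_derive_eq; apply; rewrite /GRing.scale/=.
  rewrite [r ^+ N.+2]exprS [r ^+ N.+1]exprS; field.
  by rewrite expf_neq0 gt_eqF.
(* Both [h + q] and [- h + q] are nonincreasing. *)
have mono (b : bool) (r s : R) : 0 < r -> r <= s ->
    (-1) ^+ b * h s + q s <= (-1) ^+ b * h r + q r.
  move=> r0 rs; pose H t := (-1) ^+ b * h t + q t.
  have dH (t : R) : 0 < t -> is_derive t 1 H ((-1) ^+ b * dh t -
      (A * N.+1%:R) * t ^- N.+2).
    move=> t0; have := dq t t0 => dqt; have := dhh t => dht.
    have d1 : is_derive t 1 (fun t => (-1) ^+ b * h t) ((-1) ^+ b *: dh t).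
      exact: is_deriveZ.
    have : is_derive t 1 H ((-1) ^+ b *: dh t + - (A * N.+1%:R) * t ^- N.+2).
      exact: is_deriveD.
    by rewrite mulNr.
  have [||c cs E] := @MVT_segment _ H (fun t =>
      (-1) ^+ b * dh t - (A * N.+1%:R) * t ^- N.+2) r s rs.
  - by move=> t; rewrite in_itv/= => /andP[rt _]; apply: dH; rewrite (lt_trans r0).
  - apply: derivable_within_continuous => t; rewrite in_itv/= => /andP[rt _].
    by case: (dH t (lt_le_trans r0 rt)).
  move: cs; rewrite in_itv/= => /andP[rc _]; have c0 := lt_le_trans r0 rc.
  rewrite -subr_le0 -[_ - _]/(H s - H r) E mulr_le0_ge0 ?subr_ge0// subr_le0.
  have p : 0 < c ^+ N.+2 by rewrite exprn_gt0.
  rewrite ler_pdivlMr// mulrC (@le_trans _ _ A)//; last by rewrite ler_peMr// ler1n.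
  rewrite (le_trans _ (dhA c c0))// ler_wpM2l// ?(ltW p)//.
  by rewrite (le_trans (ler_norm _))// normrM normrX normrN1 expr1n mul1r.
have hle r s : 0 < r -> 0 < s -> h r - q r <= h s + q s.
  move=> r0 s0.
  have q0 t : 0 < t -> 0 <= q t by move=> t0;
      rewrite mulr_ge0// invr_ge0 exprn_ge0// ltW.
  have [rs|sr] := leP r s.
    have := mono true r s r0 rs; rewrite !expr1; have := q0 s s0; lra.
  have := mono false s r s0 (ltW sr); rewrite !expr0; have := q0 r r0; lra.
pose S : set R := [set h r - q r | r in [set r | 0 < r]].
have S1 : S (h 1 - q 1) by exists 1 => //=; exact: ltr01.
have Sub r : 0 < r -> ubound S (h r + q r).
  by move=> r0 _ [s /= s0 <-]; exact: hle.
exists (sup S) => r r0.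
have l1 : h r - q r <= sup S.
  by apply: ub_le_sup; [exists (h 1 + q 1); exact: Sub|exists r].
have l2 : sup S <= h r + q r.
  by apply: ge_sup; [exists (h 1 - q 1)|exact: Sub].
rewrite mulrC -ler_pdivlMr ?exprn_gt0// ler_norml -/(q r); apply/andP; split; lra.
Qed.

(** A closed form decaying like [|x| ^- N.+2] has a potential decaying like
    [|x| ^- N.+1]. *)
Lemma decaying_potential (n : nat) (hn : (2 <= n)%N) (w : 'I_n -> 'rV[R]_n -> R)
    (N : nat) :
  (forall i, C1 (w i)) ->
  (forall i j x, partial i (w j) x = partial j (w i) x) ->
  (exists C, forall i x, `|x| ^+ N.+2 * `|w i x| <= C) ->
  exists v : 'rV[R]_n -> R,
    [/\ forall i x, derivable v x (delta_mx 0 i),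
        forall i, partial i v = w i &
        exists C, forall x, `|x| ^+ N.+1 * `|v x| <= C].
Proof.
move=> Cw clw [C wC].
pose v0 := radial_potential w.
have dv0 i x : derivable v0 x (delta_mx 0 i) by case:
    (radial_potential_derive Cw clw i x).
have pv0 i : partial i v0 = w i.
  by apply/funext => x; case: (radial_potential_derive Cw clw i x).
have Cv0 : C1 v0.
  by move=> i; split; [exact: dv0|rewrite pv0; exact: C1_continuous].
have C0 : 0 <= C.
  have i0 : 'I_n by exact: (Ordinal (ltnW hn)).
  by rewrite (le_trans _ (wC i0 0))// mulr_ge0// exprn_ge0.
pose one : 'rV[R]_n := const_mx 1.
have normr1 (r : R) : 0 < r -> `|r *: one| = r.
  move=> r0; apply/eqP; rewrite eq_le; apply/andP; split.
    by apply: norm_le_coord => [|i]; [exact: ltW|rewrite !mxE mulr1 gtr0_norm].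
  have := coord_le_norm (r *: one) (Ordinal (ltnW hn)).
  by rewrite !mxE mulr1 gtr0_norm.
have [L HL] : exists L, forall r, 0 < r -> r ^+ N.+1 * `|v0 (r *: one) - L| <= n%:R * C.
  apply: (@derive_decay_limit _ (fun r =>
      \sum_(i < n) one 0 i * partial i v0 (0 + r *: one))).
    move=> r; have := C1_is_derive 0 one r Cv0.
    rewrite (_ : (fun s : R => _) = (fun r => v0 (r *: one)))//.
    by apply/funext => s; rewrite add0r.
  move=> r r0; rewrite (@le_trans _ _ (r ^+ N.+2 * \sum_(i < n) `|w i (r *: one)|))//.
    rewrite ler_wpM2l ?exprn_ge0 ?(ltW r0)// (le_trans (ler_norm_sum _ _ _))//.
    by rewrite ler_sum// => i _; rewrite mxE mul1r pv0 add0r.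
  rewrite mulr_sumr; apply: sumr_const_le => i.
  by have := wC i (r *: one); rewrite normr1.
(* A displacement of size [2 r] at distance at least [r] from the origin
   changes the potential by [O(r ^- N.+1)]. *)
have seg (r : R) y u : 0 < r -> `|u| <= 2 * r ->
    (forall s : R, 0 <= s <= 1 -> r <= `|y + s *: u|) ->
    r ^+ N.+1 * `|v0 (y + u) - v0 y| <= n%:R * (2 * C).
  move=> r0 ur H; have [s s01 ->] := segment_MVT y u Cv0.
  rewrite (@le_trans _ _ (r ^+ N.+1 * \sum_(i < n) (2 * r) * `|w i (y + s *: u)|))//.
    rewrite ler_wpM2l ?exprn_ge0 ?(ltW r0)// (le_trans (ler_norm_sum _ _ _))//.
    rewrite ler_sum// => i _; rewrite normrM pv0 ler_wpM2r//.
    by rewrite (le_trans (coord_le_norm _ _)).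
  rewrite mulr_sumr; apply: sumr_const_le => i.
  rewrite mulrA mulrCA -exprSr -mulrA ler_wpM2l// (le_trans _ (wC i (y + s *: u)))//.
  by rewrite ler_wpM2r// lerXn2r ?nnegrE ?(ltW r0)//; exact: H.
exists (fun x => v0 x - L); split.
- by move=> i x; apply: derivableB; [exact: dv0|exact: derivable_cst].
- move=> i; apply/funext => x; rewrite -pv0 /partial.
  rewrite deriveB; [by rewrite derive_cst subr0|exact: dv0|exact: derivable_cst].
exists (n%:R * (5 * C)) => x; have [->|x0] := eqVneq x 0.
  by rewrite normr0 expr0n mul0r !mulr_ge0.
have r0 : 0 < `|x| by rewrite normr_gt0.
have [i xi] := norm_coord x0.
have [k ki] : exists k : 'I_n, k != i.
  have h0 : (0 < n)%N by exact: ltnW.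
  have [i0|i0] := eqVneq (i : nat) 0%N.
    by exists (Ordinal hn); apply/eqP => e; move: i0; rewrite -e.
  by exists (Ordinal h0); apply/eqP => e; move: i0; rewrite -e.
pose r := `|x|; pose u1 : 'rV[R]_n := (r - x 0 k) *: delta_mx 0 k.
(* First raise the coordinate [k] to [r] while the coordinate [i] keeps the
   distance, then move to [r *: one] while the coordinate [k] keeps it. *)
pose y := x + u1; pose u2 : 'rV[R]_n := r *: one - y.
have yk : y 0 k = r by rewrite !mxE !eqxx/= mulr1 addrC subrK.
have yl : `|y| <= r.
  apply: norm_le_coord => [|j]; first exact: ltW.
  have [->|jk] := eqVneq j k; first by rewrite yk gtr0_norm.
  by rewrite !mxE eqxx (negbTE jk) mulr0 addr0 coord_le_norm.
have s1 : r ^+ N.+1 * `|v0 y - v0 x| <= n%:R * (2 * C).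
  apply: seg => //.
    apply: norm_le_coord => [|j]; first by rewrite mulr_ge0// ltW.
    rewrite !mxE eqxx/=; case: eqP => _; rewrite ?mulr0 ?normr0 ?mulr_ge0 ?(ltW r0)//.
    rewrite mulr1 (le_trans (ler_normB _ _))// (gtr0_norm r0) mulrDl mul1r lerD2l.
    exact: coord_le_norm.
  move=> s _; rewrite /r xi (le_trans _ (coord_le_norm _ i))// !mxE eqxx/=.
  by rewrite eq_sym (negbTE ki) !mulr0 addr0.
have s2 : r ^+ N.+1 * `|v0 (r *: one) - v0 y| <= n%:R * (2 * C).
  have -> : r *: one = y + u2 by rewrite addrC subrK.
  apply: seg => //.
    by rewrite (le_trans (ler_normB _ _))// normr1// mulrDl mul1r lerD2l.
  have u2k : u2 0 k = 0.
    by rewrite /u2 mxE [X in _ + X]mxE yk mxE mxE mulr1 subrr.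
  move=> s _; have := coord_le_norm (y + s *: u2) k.
  by rewrite mxE [X in _ + X]mxE yk u2k mulr0 addr0 gtr0_norm.
have s3 := HL r r0.
rewrite -/r; have -> : v0 x - L =
    (v0 (r *: one) - L) - (v0 (r *: one) - v0 y) - (v0 y - v0 x) by ring.
rewrite (le_trans (ler_wpM2l _ (ler_normB _ _))) ?exprn_ge0 ?(ltW r0)//.
rewrite mulrDr (le_trans (lerD (ler_wpM2l _
    (ler_normB _ _)) s1)) ?exprn_ge0 ?(ltW r0)//.
rewrite mulrDr (le_trans (lerD (lerD s3 s2) (lexx _)))//.
by rewrite le_eqVlt; apply/orP; left; apply/eqP; ring.
Qed.

End DecayingPotential.

(** * The elastic ray transform *)

Section Norms.
Context {R : realType} {n : nat}.
Implicit Types (x y : 'rV[R]_n) (g : 'rV[R]_n -> R).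

Lemma dotp_ge0 x : 0 <= dotp x x.
Proof. by apply: sumr_ge0 => i _; rewrite -expr2 sqr_ge0. Qed.

Lemma norm_le_enorm x : `|x| <= enorm x.
Proof.
apply: norm_le_coord => [|i]; first exact: sqrtr_ge0.
rewrite -sqrtr_sqr ler_sqrt ?dotp_ge0// /dotp (bigD1 i)//= -expr2 lerDl.
by apply: sumr_ge0 => j _; rewrite -expr2 sqr_ge0.
Qed.

Lemma enorm_le_norm x : enorm x <= n%:R * `|x|.
Proof.
rewrite -[leRHS]ger0_norm ?mulr_ge0// -sqrtr_sqr ler_sqrt ?sqr_ge0//.
rewrite (@le_trans _ _ (n%:R * `|x| ^+ 2))//.
  apply: sumr_const_le => i; rewrite -expr2 -real_normK ?num_real//.
  by rewrite lerXn2r ?nnegrE// coord_le_norm.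
rewrite exprMn ler_wpM2r ?sqr_ge0// expr2.
by case: (n) => [|m]; rewrite ?mul0r// ler_peMr// ler1n.
Qed.

Lemma enorm_gt0 x : x != 0 -> 0 < enorm x.
Proof.
by move=> x0; rewrite (lt_le_trans _ (norm_le_enorm x))// normr_gt0.
Qed.

Lemma cvg_at_infty_decay g N C : (forall x, `|x| ^+ N.+1 * `|g x| <= C) ->
  g x @[x --> @at_infty R n] --> 0.
Proof.
move=> gC; have C0 : 0 <= C by rewrite (le_trans _ (gC 0))// mulr_ge0// exprn_ge0.
apply/cvgr0Pnorm_le => e e0.
exists (n%:R * Num.max 1 (C / e)) => x Mx.
have := lt_le_trans Mx (enorm_le_norm x) => {}Mx.
have xM : Num.max 1 (C / e) < `|x|.
  have n0 : (0 : R) < n%:R.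
    rewrite ltr0n lt0n; apply/negP => /eqP n0.
    have e0n : n%:R = 0 :> R by rewrite n0.
    by move: Mx; rewrite e0n !mul0r ltxx.
  by rewrite ltr_pM2l in Mx.
move: xM; rewrite gt_max => /andP[x1 xC].
have x0 : 0 < `|x| by rewrite (lt_trans ltr01).
have p : 0 < `|x| ^+ N.+1 by rewrite exprn_gt0.
rewrite -(ler_pM2l p) (le_trans (gC x))//.
rewrite ltr_pdivrMr// in xC; rewrite (le_trans (ltW xC))// ler_pM2r//.
by rewrite exprS ler_peMr// ?(ltW x0)// exprn_ege1// ltW.
Qed.

Lemma cvg_line_at_infty x y : y != 0 ->
  (x + t *: y) @[t --> +oo] --> @at_infty R n.
Proof.
move=> y0 P [M MP]; have ny : 0 < `|y| by rewrite normr_gt0.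
suff : \forall t \near +oo, P (x + t *: y) by [].
near=> t; apply: MP; rewrite (lt_le_trans _ (norm_le_enorm _))//.
have t0 : 0 < t by near: t; exact: nbhs_pinfty_gt.
have h : (M + `|x|) / `|y| < t by near: t; apply: nbhs_pinfty_gt; rewrite num_real.
rewrite ltr_pdivrMr// in h.
have : `|t *: y| <= `|x + t *: y| + `|x|.
  by rewrite -{1}[t *: y](addKr x) (le_trans (ler_normD _ _))// normrN addrC.
rewrite normrZ (gtr0_norm t0) => h2.
by rewrite -(ltrD2r `|x|) (lt_le_trans h).
Unshelve. all: by end_near. Qed.

End Norms.

Section Smooth.
Context {R : realType} {n : nat}.
Implicit Types (x y : 'rV[R]_n) (g : 'rV[R]_n -> R).

(** In [iter_partial] the last index acts first, so smoothness of [g] is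
    inherited from its first partial derivatives. *)
Lemma smooth_partials g : (forall i x, derivable g x (delta_mx 0 i)) ->
  (forall i, smooth (partial i g)) -> smooth g.
Proof.
move=> dg sg s; have [->|[s' [i ->]]] : s = [::] \/ exists s' i, s = rcons s' i.
  by case: (lastP s) => [|s' i]; [left|right; exists s', i].
  split; last by move=> i x; exact: dg.
  by apply: C1_continuous => i; split; [exact: dg|exact: (sg i [::]).1].
by rewrite /iter_partial foldr_rcons; exact: sg.
Qed.

Lemma schwartz_C1 g : schwartz g -> C1 g.
Proof. by move=> [sg _]; exact: (@smooth_C1 _ _ g [::]). Qed.

End Smooth.

Section Equivalence.
Context {R : realType} {n : nat}.
Notation mu := (@lebesgue_measure R).
Variable f : 'rV[R]_n -> 'M[R]_n.
Hypothesis hn : (2 <= n)%N.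
Hypothesis hf : schwartz_sym_tensor_field f.

Let fs i j x : f x i j = f x j i.
Proof. by rewrite -[in LHS](hf.1 x) mxE. Qed.

Let sf i j : schwartz (fun x => f x i j) := hf.2 i j.

Lemma saint_venant_hessian :
  (forall (i j k : 'I_n) x, saint_venant f i j k x = 0) ->
  exists phi : 'rV[R]_n -> R,
    [/\ smooth phi, forall x, f x = hessian phi x,
        phi x @[x --> @at_infty R n] --> (0 : R) &
        forall i : 'I_n, partial i phi x @[x --> @at_infty R n] --> (0 : R)].
Proof.
move=> H.
have cl (i j k : 'I_n) x : partial k (fun y => f y i j) x = partial j (fun y =>
    f y i k) x.
  have := H i j k x; rewrite /saint_venant => /eqP.
  by rewrite mulf_eq0 invr_eq0 pnatr_eq0/= subr_eq0 => /eqP.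
have Hv (j : 'I_n) : exists v : 'rV[R]_n -> R,
    [/\ forall i x, derivable v x (delta_mx 0 i),
        forall i, partial i v = fun x => f x j i &
        exists C, forall x, `|x| ^+ 2 * `|v x| <= C].
  apply: decaying_potential => //.
  - by move=> i; exact: schwartz_C1.
  - have /choice[C HC] : forall i, exists C, forall x, `|x| ^+ 3 * `|f x j i| <= C.
      by move=> i; exact: schwartz_norm_decay.
    exists (\sum_i `|C i|) => i x;
        rewrite (le_trans (HC i x))// (le_trans (ler_norm _))//.
    by rewrite (bigD1 i)//= lerDl sumr_ge0.
have /choice[v /all_and3[dv pv vC]] := Hv.
have Cv j : C1 (v j).
  move=> i; split; first exact: dv.
  by rewrite pv; exact: C1_continuous (schwartz_C1 (sf j i)).
have [phi [dphi pphi [C phiC]]] : exists phi : 'rV[R]_n -> R,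
    [/\ forall i x, derivable phi x (delta_mx 0 i),
        forall i, partial i phi = v i &
        exists C, forall x, `|x| ^+ 1 * `|phi x| <= C].
  apply: decaying_potential => //.
  - by move=> i j x; rewrite !pv fs.
  - have /choice[C HC] := vC.
    exists (\sum_i `|C i|) => i x;
        rewrite (le_trans (HC i x))// (le_trans (ler_norm _))//.
    by rewrite (bigD1 i)//= lerDl sumr_ge0.
exists phi; split.
- apply: smooth_partials => // j; rewrite pphi.
  by apply: smooth_partials => // i; rewrite pv; exact: (sf j i).1.
- by move=> x; apply/matrixP => i j; rewrite mxE pphi pv fs.
- exact: cvg_at_infty_decay phiC.
- move=> i; rewrite pphi; have [D vD] := vC i; exact: cvg_at_infty_decay vD.
Qed.

Lemma integrable_line i j x xi : xi != 0 ->
  mu.-integrable [set: R] (EFin \o (fun t : R => f (x + t *: xi) i j)).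
Proof.
move=> xi0; have [C HC] := schwartz_line [::] x (sf i j) xi0.
apply: integrable_le_bump HC; apply: continuous_measurable_fun => t.
apply/differentiable_continuous/derivable1_diffP.
by case: (C1_is_derive x xi t (schwartz_C1 (sf i j))).
Qed.

Lemma Rintegral_sum (I : Type) (r : seq I) (h : I -> R -> R) :
  (forall i, mu.-integrable [set: R] (EFin \o h i)) ->
  \sum_(i <- r) \int[mu]_t h i t = \int[mu]_t \sum_(i <- r) h i t /\
  mu.-integrable [set: R] (EFin \o (fun t => \sum_(i <- r) h i t)).
Proof.
move=> ih; elim: r => [|i r [IH1 IH2]].
  rewrite big_nil; under eq_Rintegral do rewrite big_nil.
  split; first by rewrite Rintegral_cst// mul0r.
  rewrite (_ : _ \o _ = cst 0%E); first exact: integrable0.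
  by apply/funext => t; rewrite /= big_nil.
have E : (fun t => \sum_(k <- i :: r) h k t) = (fun t => h i t + \sum_(k <- r) h k t).
  by apply/funext => t; rewrite big_cons.
rewrite E big_cons IH1 RintegralD//; split => //.
exact: (integrableD _ (ih i) IH2).
Qed.

(** The ray transform is the pairing of the second tensor argument with the
    line integral of the contraction of [f] with the direction. *)
Lemma elastic_ray_transformE x xi zeta : xi != 0 ->
  elastic_ray_transform f x xi zeta =
  \sum_(j < n) zeta 0 j * \int[mu]_t \sum_(i < n) f (x + t *: xi) j i * xi 0 i.
Proof.
move=> xi0; rewrite /elastic_ray_transform exchange_big/=; apply: eq_bigr => j _.
have ii i : mu.-integrable [set: R] (EFin \o (fun t : R =>
    f (x + t *: xi) j i * xi 0 i)).
  exact: (integrableZr _ _ (integrable_line j i x xi0)).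
rewrite -(Rintegral_sum _ ii).1 mulr_sumr; apply: eq_bigr => i _.
rewrite mulrC -RintegralZr//; apply: eq_Rintegral => t _.
by rewrite fs.
Qed.

Lemma hessian_ray_transform :
  (exists phi : 'rV[R]_n -> R,
    [/\ smooth phi, forall x, f x = hessian phi x,
        phi x @[x --> @at_infty R n] --> (0 : R) &
        forall i : 'I_n, partial i phi x @[x --> @at_infty R n] --> (0 : R)]) ->
  forall x xi zeta : 'rV[R]_n, Zset (xi, zeta) ->
    elastic_ray_transform f x xi zeta = 0.
Proof.
move=> [phi [sphi fphi _ dphi0]] x xi zeta [/= xi1 _].
have xi0 : xi != 0.
  apply/eqP => xi0; move: xi1; rewrite /unit_sphere/= /enorm /dotp xi0.
  rewrite big1 ?sqrtr0; first by move/eqP; rewrite eq_sym oner_eq0.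
  by move=> i _; rewrite mxE mul0r.
rewrite elastic_ray_transformE// big1// => j _.
rewrite [X in _ * X](_ : _ = 0) ?mulr0//.
have Cj : C1 (partial j phi) by exact: (@smooth_C1 _ _ phi [:: j]).
have dF (t : R) : is_derive t 1 (fun t => partial j phi (x + t *: xi))
    (\sum_(i < n) f (x + t *: xi) j i * xi 0 i).
  have := C1_is_derive x xi t Cj.
  rewrite (_ : \sum_(i < n) xi 0 i * partial i (partial j phi) (x + t *: xi) =
    \sum_(i < n) f (x + t *: xi) j i * xi 0 i)//.
  by apply: eq_bigr => i _; rewrite fs fphi mxE mulrC.
have /choice[C HC] : forall i, exists C, forall t :
    R, `|f (x + t *: xi) j i| <= C * bump t.
  by move=> i; exact: (schwartz_line [::] x (sf j i) xi0).
apply: (@Rintegral_derive_eq0 _ (fun t =>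
    partial j phi (x + t *: xi)) _ (\sum_i C i * `|xi 0 i|)).
- move=> t; apply: cvg_sumr => i; apply: cvgM; last exact: cvg_cst.
  apply: differentiable_continuous; apply/derivable1_diffP.
  by case: (C1_is_derive x xi t (schwartz_C1 (sf j i))).
- move=> t; rewrite (le_trans (ler_norm_sum _ _ _))// mulr_suml ler_sum// => i _.
  by rewrite normrM mulrAC ler_wpM2r.
- exact: cvg_comp (cvg_line_at_infty x xi0) (dphi0 j).
- apply/cvgNy_compNP.
  have xi0' : - xi != 0 by rewrite oppr_eq0.
  have := cvg_comp _ _ (cvg_line_at_infty x xi0') (dphi0 j).
  rewrite (_ : _ \o _ = ((fun t => partial j phi (x + t *: xi)) \o -%R))//.
  by apply/funext => t /=; rewrite scalerN scaleNr.
Qed.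

Section vanishing_ray_transform.
Hypothesis X0 : forall x xi zeta : 'rV[R]_n, Zset (xi, zeta) ->
  elastic_ray_transform f x xi zeta = 0.

(** Testing against [zeta] in [R xi] and in [xi^perp] tests against every
    [zeta], so each row of [f], seen as a one-form, has zero line integrals. *)
Lemma row_unit_line_eq0 x xi j : enorm xi = 1 ->
  \int[mu]_t \sum_(i < n) f (x + t *: xi) j i * xi 0 i = 0.
Proof.
move=> xi1.
have dxi : dotp xi xi = 1 by rewrite -[LHS]sqr_sqrtr ?dotp_ge0//
    -/(enorm xi) xi1 expr1n.
have xi0 : xi != 0.
  apply/eqP => xi0; move: dxi; rewrite /dotp big1.
    by move/eqP; rewrite eq_sym oner_eq0.
  by move=> i _; rewrite xi0 mxE mul0r.
pose h j := \int[mu]_t \sum_(i < n) f (x + t *: xi) j i * xi 0 i.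
have X0' zeta : Zset (xi, zeta) -> \sum_(j < n) zeta 0 j * h j = 0.
  by move=> hz; rewrite -[RHS](@X0 x _ _ hz) elastic_ray_transformE.
have h1 : \sum_(k < n) xi 0 k * h k = 0.
  by apply: X0'; split => //=; left; exists 1 => //; rewrite scale1r.
(* The basis vector [e] is the sum of [xi 0 j *: xi] and of a vector of [xi^perp]. *)
pose e : 'rV[R]_n := delta_mx 0 j.
have dote : dotp xi e = xi 0 j.
  rewrite /dotp (bigD1 j)//= mxE !eqxx mulr1 big1 ?addr0// => i /negbTE ij.
  by rewrite mxE ij andbF mulr0.
have h2 : \sum_(k < n) (e - xi 0 j *: xi) 0 k * h k = 0.
  apply: X0'; split => //=; right => /=.
  transitivity (dotp xi e - xi 0 j * dotp xi xi); last by rewrite dote dxi mulr1 subrr.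
  by rewrite /dotp mulr_sumr -sumrB; apply: eq_bigr => i _; rewrite !mxE; ring.
rewrite -/(h j).
have : \sum_(k < n) (e - xi 0 j *: xi) 0 k * h k =
    h j - xi 0 j * \sum_(k < n) xi 0 k * h k.
  transitivity (\sum_(k < n) e 0 k * h k - \sum_(k < n) xi 0 j * (xi 0 k * h k)).
    by rewrite -sumrB; apply: eq_bigr => k _; rewrite !mxE; ring.
  rewrite -mulr_sumr; congr (_ - _).
  rewrite (bigD1 j)//= mxE !eqxx mul1r big1 ?addr0// => i /negbTE ij.
  by rewrite mxE ij andbF mul0r.
by rewrite h1 h2 mulr0 subr0.
Qed.

Lemma row_line_eq0 x v j : v != 0 ->
  \int[mu]_t \sum_(i < n) f (x + t *: v) j i * v 0 i = 0.
Proof.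
move=> v0; have m0 := enorm_gt0 v0; pose xi := (enorm v)^-1 *: v.
have mn0 : enorm v != 0 by rewrite gt_eqF.
have xi1 : enorm xi = 1.
  rewrite /enorm (_ : dotp xi xi = (enorm v)^-1 ^+ 2 * dotp v v).
    by rewrite -[dotp v v]sqr_sqrtr ?dotp_ge0// -/(enorm v) -exprMn mulVf//
        expr1n sqrtr1.
  by rewrite /dotp mulr_sumr; apply: eq_bigr => i _; rewrite !mxE; ring.
have vE : v = enorm v *: xi by rewrite scalerA mulfV// scale1r.
have xi0 : xi != 0 by rewrite scaler_eq0 invr_eq0 (negbTE mn0) (negbTE v0).
pose g (t : R) := \sum_(i < n) f (x + t *: xi) j i * xi 0 i.
have cg : continuous g.
  move=> t; apply: cvg_sumr => i; apply: cvgM; last exact: cvg_cst.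
  apply: differentiable_continuous; apply/derivable1_diffP.
  by case: (C1_is_derive x xi t (schwartz_C1 (sf j i))).
have /choice[C HC] : forall i, exists C, forall t :
    R, `|f (x + t *: xi) j i| <= C * bump t.
  by move=> i; exact: (schwartz_line [::] x (sf j i) xi0).
have gC t : `|g t| <= (\sum_i C i * `|xi 0 i|) * bump t.
  rewrite (le_trans (ler_norm_sum _ _ _))// mulr_suml ler_sum// => i _.
  by rewrite normrM mulrAC ler_wpM2r.
have := Rintegral_affine 0 m0 cg gC; rewrite (row_unit_line_eq0 x j xi1) => /esym/eqP.
rewrite mulf_eq0 (negbTE mn0)/= => /eqP E.
have E2 : (fun t => \sum_(i < n) f (x + t *: v) j i * v 0 i) =
    (fun t => enorm v * g (enorm v * t + 0)).
  apply/funext => t; rewrite /g mulr_sumr; apply: eq_bigr => i _.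
  have vi : v 0 i = enorm v * xi 0 i by rewrite [in LHS]vE mxE.
  by rewrite addr0 [enorm v * t]mulrC -scalerA -vE vi mulrCA.
have ig : mu.-integrable [set: R] (EFin \o (fun t => g (enorm v * t + 0))).
  have [_ h] := Rintegral_sum (index_enum 'I_n)
    (fun i => integrableZr measurableT (xi 0 i) (integrable_line j i x v0)).
  move: h; congr (integrable _ _ _); apply/funext => t /=; congr EFin.
  apply: eq_bigr => i _; rewrite addr0 [enorm v * t]mulrC -scalerA -vE//.
by rewrite E2 RintegralZl// E mulr0.
Qed.

Lemma cvg_plane_point (T : Type) (F : set_system T) (FF : Filter F) (u v : T -> R)
    (a b : R) (x d e : 'rV[R]_n) :
  u t @[t --> F] --> a -> v t @[t --> F] --> b ->
  x + (u t *: d + v t *: e) @[t --> F] --> x + (a *: d + b *: e).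
Proof.
move=> ua vb; apply: cvgD; first exact: cvg_cst.
by apply: cvgD; exact: cvgZr_tmp.
Qed.

Lemma ray_transform_saint_venant (i j k : 'I_n) x : saint_venant f i j k x = 0.
Proof.
rewrite /saint_venant; have [->|jk] := eqVneq j k; first by rewrite subrr mulr0.
have kj : k != j by rewrite eq_sym.
apply/eqP; rewrite mulf_eq0 subr_eq0; apply/orP; right; apply/eqP.
pose ej : 'rV[R]_n := delta_mx 0 j; pose ek : 'rV[R]_n := delta_mx 0 k.
pose pt (s t : R) := x + (s *: ej + t *: ek).
pose a s t := f (pt s t) i j; pose b s t := f (pt s t) i k.
pose wa s t := partial k (fun y => f y i j) (pt s t).
pose wb s t := partial j (fun y => f y i k) (pt s t).
have [Ca Ca0 aC] := schwartz_plane [::] x (sf i j) jk.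
have [Cb Cb0 bC] := schwartz_plane [::] x (sf i k) jk.
have [Cwa Cwa0 waC] := schwartz_plane [:: k] x (sf i j) jk.
have [Cwb Cwb0 wbC] := schwartz_plane [:: j] x (sf i k) jk.
pose K := Ca + Cb + Cwa + Cwb.
have b0 (s t : R) : 0 <= bump s ^+ 2 * bump t.
  by rewrite mulr_ge0 ?exprn_ge0// ltW// bump_gt0.
have cpt : continuous (fun p : R * R => pt p.1 p.2).
  move=> p; apply: (@cvg_plane_point _ (nbhs p)); [exact: cvg_fst|exact: cvg_snd].
have cpl g : continuous g -> plane_continuous (fun s t => g (pt s t)).
  by move=> cg p; exact: (cvg_comp _ _ (cpt p) (cg _)).
have ptE s t : pt s t = (x + s *: ej) + t *: ek by rewrite /pt addrA.
have ptE' s t : pt s t = (x + t *: ek) + s *: ej by rewrite /pt addrCA addrC.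
have : wb 0 0 = wa 0 0.
  apply: (@plane_form_closed _ a b wa wb K).
  - exact: (cpl _ (@C1_continuous _ _ _ (schwartz_C1 (sf i j)))).
  - exact: (cpl _ (@C1_continuous _ _ _ (schwartz_C1 (sf i k)))).
  - exact: (cpl _ (schwartz_C1 (sf i j) k).2).
  - exact: (cpl _ (schwartz_C1 (sf i k) j).2).
  - by move=> s t; rewrite (le_trans (aC s t))// ler_wpM2r// /K; lra.
  - by move=> s t; rewrite (le_trans (bC s t))// ler_wpM2r// /K; lra.
  - by move=> s t; rewrite (le_trans (waC s t))// ler_wpM2r// /K; lra.
  - by move=> s t; rewrite (le_trans (wbC s t))// ler_wpM2r// /K; lra.
  - move=> s t; have := is_derive_partial (x + s *: ej) k t (schwartz_C1 (sf i j)).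
    by rewrite -/ek -ptE (_ : (fun s0 : R => _) = a s)//; apply/funext => r;
        rewrite -ptE.
  - move=> s t; have := is_derive_partial (x + t *: ek) j s (schwartz_C1 (sf i k)).
    by rewrite -/ej -ptE' (_ : (fun s0 : R => _) = b ^~ t)//; apply/funext => r;
        rewrite -ptE'.
  - move=> c t; pose v : 'rV[R]_n := ej - c *: ek.
    have v0 : v != 0.
      apply/eqP => /matrixP/(_ 0 j); rewrite !mxE !eqxx/= (negbTE jk) mulr0 subr0.
      by move/eqP; rewrite oner_eq0.
    rewrite -[RHS](row_line_eq0 (x + t *: ek) i v0); apply: eq_Rintegral => s _.
    have -> : (x + t *: ek) + s *: v = pt s (t - c * s).
      rewrite /pt /v scalerBr scalerBl scalerA [s * c]mulrC -!addrA; congr (_ + _).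
      by rewrite addrCA.
    rewrite (bigD1 j)//= (bigD1 k)//= big1 => [|l /andP[/negbTE lj /negbTE lk]].
      by rewrite !mxE !eqxx/= (negbTE jk) (negbTE kj) /a /b mulr0n; ring.
    by rewrite !mxE lj lk /= !mulr0 subr0 mulr0.
  - move=> s; have v0 : ek != 0.
      by apply/eqP => /matrixP/(_ 0 k); rewrite !mxE !eqxx/= => /eqP; rewrite oner_eq0.
    rewrite -[RHS](row_line_eq0 (x + s *: ej) i v0); apply: eq_Rintegral => t _.
    rewrite -ptE (bigD1 k)//= big1 => [|l /negbTE lk]; last by rewrite !mxE lk mulr0.
    by rewrite mxE !eqxx mulr1 addr0.
have -> : x = pt 0 0 by rewrite /pt !scale0r !addr0.
by [].
Qed.

End vanishing_ray_transform.
End Equivalence.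

Theorem corollary14 (R : realType) (n : nat) (hn : (2 <= n)%N)
    (f : 'rV[R]_n -> 'M[R]_n) (hf : schwartz_sym_tensor_field f) :
  [<-> (* (a) *)
       forall x xi zeta : 'rV[R]_n, Zset (xi, zeta) ->
         elastic_ray_transform f x xi zeta = 0;
       (* (b) *)
       exists phi : 'rV[R]_n -> R,
         [/\ smooth phi,
             forall x, f x = hessian phi x,
             phi x @[x --> @at_infty R n] --> (0 : R) &
             forall i : 'I_n,
               partial i phi x @[x --> @at_infty R n] --> (0 : R)];
       (* (c) *)
       forall (i j k : 'I_n) (x : 'rV[R]_n), saint_venant f i j k x = 0].
Proof.
split; first by move/(ray_transform_saint_venant hf); exact: saint_venant_hessian.
split; first by move/(hessian_ray_transform hf); exact: ray_transform_saint_venant.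
by move/(saint_venant_hessian hn hf); exact: hessian_ray_transform.
Qed.
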